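(* Let $(\bar u,\bar y,\bar\varphi)\in U_{\rm ad}\times[H^1(\Omega)\cap C^{0,\mu}(\bar\Omega)]^2$ satisfy the first order optimality system $$A\bar y+a(x,\bar y)+\bar u\bar y=0\ \text{ in }\Omega,\quad\partial_{n_A}\bar y=g\ \text{ on }\Gamma,$$ $$A^*\bar\varphi+\frac{\partial a}{\partial y}(x,\bar y)\bar\varphi+\bar u\bar\varphi=\frac{\partial L}{\partial y}(x,\bar y)\ \text{ in }\Omega,\quad\partial_{n_{A^*}}\bar\varphi=0\ \text{ on }\Gamma,$$ $$\bar u(x)=\operatorname{Proj}_{[\alpha,\beta]}\Big(\frac1\nu\bar y(x)\bar\varphi(x)\Big)\ \text{ for a.a. }x\in\Omega.$$ Assume that $\bar u$ satisfies the strict complementarity condition $|\Sigma_{\bar u}|=0$. Then the following properties hold: 1. $T_{\bar u}=C_{\bar u}$. 2. If $\bar u$ satisfies the second order optimality condition $J''(\bar u)v^2>0$ for all $v\in C_{\bar u}\setminus\{0\}$, then there exist $\tau>0$ and $\kappa>0$ such that $$J''(\bar u)v^2\ge\kappa\|v\|^2_{L^2(\Omega)}\quad\forall v\in T^\tau_{\bar u}.$$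
   Context: $\Omega\subset\mathbb{R}^d$, $d\in\{2,3\}$, is a bounded open connected set with Lipschitz boundary $\Gamma$. Operator: $Ay=-\sum_{i,j=1}^d\partial_{x_j}[a_{ij}(x)\partial_{x_i}y]$ with $a_{ij}\in L^\infty(\Omega)$ and, for some $M_A,\Lambda_A>0$, $M_A|\xi|^2\ge\sum_{i,j}a_{ij}(x)\xi_i\xi_j\ge\Lambda_A|\xi|^2$ for a.a. $x\in\Omega$ and all $\xi\in\mathbb{R}^d$; $\partial_{n_A}y=\sum_{i,j}a_{ij}\partial_{x_i}y\,n_j$ with $n$ the outward unit normal. $A^*$ and $\partial_{n_{A^*}}$ are defined in the same way with $a_{ji}$ in place of $a_{ij}$. Equations are understood in the weak $H^1(\Omega)$ sense. Nonlinearity: $a:\Omega\times\mathbb{R}\to\mathbb{R}$ is a Carathéodory function, of class $C^2$ in the second variable, such that for a.a. $x\in\Omega$: $a(\cdot,0)\in L^p(\Omega)$ for some $p>d/2$; $\frac{\partial a}{\partial y}(x,y)\ge a_0$ for all $y\in\mathbb{R}$, for some constant $a_0\ge0$; for every $M>0$ there is $C_{a,M}$ with $\sum_{j=1}^2|\frac{\partial^ja}{\partial y^j}(x,y)|\le C_{a,M}$ for all $|y|\le M$; for every $\varepsilon>0$ and $M>0$ there is $\rho>0$ with $|\frac{\partial^2a}{\partial y^2}(x,y_1)-\frac{\partial^2a}{\partial y^2}(x,y_2)|\le\varepsilon$ for all $|y_1|,|y_2|\le M$ with $|y_1-y_2|\le\rho$. Boundary datum: $g\in L^q(\Gamma)$,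 $q>d-1$. Cost integrand: $L:\Omega\times\mathbb{R}\to\mathbb{R}$ is Carathéodory, of class $C^2$ in the second variable, and for a.a. $x$: $L(\cdot,0)\in L^1(\Omega)$; for all $M>0$ there is $L_M\in L^p(\Omega)$ with $|\frac{\partial L}{\partial y}(x,y)|\le L_M(x)$ for $|y|\le M$; for all $M>0$ there is $C_{L,M}\in\mathbb{R}$ with $|\frac{\partial^2L}{\partial y^2}(x,y)|\le C_{L,M}$ for $|y|\le M$; for all $\varepsilon,M>0$ there is $\rho>0$ with $|\frac{\partial^2L}{\partial y^2}(x,y_1)-\frac{\partial^2L}{\partial y^2}(x,y_2)|\le\varepsilon$ for $|y_1|,|y_2|\le M$, $|y_1-y_2|\le\rho$. Control constraints: $\nu>0$, $-a_0<\alpha<\beta\le\infty$, $U_{\rm ad}=\{u\in L^2(\Omega):\alpha\le u(x)\le\beta\text{ a.e. in }\Omega\}$; $\operatorname{Proj}_{[\alpha,\beta]}(t)=\min\{\beta,\max\{\alpha,t\}\}$ (for $\beta=\infty$, $\max\{\alpha,t\}$). Exponent $\mu$: $\mu\in(0,1]$ is a fixed Hölder exponent provided by known elliptic regularity theory, i.e. such that, for $B\in\{A,A^*\}$, every weak solution $y\in H^1(\Omega)$ of $By+y=f$ in $\Omega$, $\partial_{n_B}y=h$ on $\Gamma$, with $f\in L^{\min\{p,2\}}(\Omega)$, $h\in L^q(\Gamma)$, belongs to $C^{0,\mu}(\bar\Omega)$ with $\|y\|_{C^{0,\mu}(\bar\Omega)}\le C(\|f\|_{L^{\min\{p,2\}}(\Omega)}+\|h\|_{L^q(\Gamma)})$.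 The open set $\mathcal{A}$ and the map $G$: let $m_u=\operatorname{ess\,inf}_\Omega u$, $\Lambda_u=\min\{\Lambda_A,a_0+m_u\}$, $\mathcal{A}_0=\{u\in L^2(\Omega):a_0+m_u>0\}$, and $C_{4,\Omega}$ a constant with $\|y\|_{L^4(\Omega)}\le C_{4,\Omega}\|y\|_{H^1(\Omega)}$ for all $y\in H^1(\Omega)$. Then $\mathcal{A}=\bigcup_{\bar u\in\mathcal{A}_0}B_{\varepsilon_{\bar u}}(\bar u)$ (open balls in $L^2(\Omega)$), with radii $0<\varepsilon_{\bar u}<\Lambda_{\bar u}/C_{4,\Omega}^2$ chosen (this is possible) so that for every $u\in\mathcal{A}$ the state equation $Ay+a(x,y)+uy=0$ in $\Omega$, $\partial_{n_A}y=g$ on $\Gamma$, has a unique solution $y_u\in H^1(\Omega)\cap C^{0,\mu}(\bar\Omega)$ and $G:\mathcal{A}\to H^1(\Omega)\cap C^{0,\mu}(\bar\Omega)$, $G(u)=y_u$, is of class $C^2$. One has $U_{\rm ad}\subset\mathcal{A}_0\subset\mathcal{A}$. For $v\in L^2(\Omega)$, $z=z_{u,v}=G'(u)v$ is the unique solution of $Az+\frac{\partial a}{\partial y}(x,y_u)z+uz+vy_u=0$ in $\Omega$, $\partial_{n_A}z=0$ on $\Gamma$. The adjoint state $\varphi_u\in H^1(\Omega)\cap C^{0,\mu}(\bar\Omega)$ is the unique solution of $A^*\varphi+\frac{\partial a}{\partial y}(x,y_u)\varphi+u\varphi=\frac{\partial L}{\partial y}(x,y_u)$ in $\Omega$, $\partial_{n_{A^*}}\varphi=0$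 on $\Gamma$. Functional: $J:\mathcal{A}\to\mathbb{R}$, $J(u)=\int_\Omega L(x,y_u)\,dx+\frac{\nu}{2}\int_\Omega u^2\,dx$, is of class $C^2$ with $J''(u)(v_1,v_2)=\int_\Omega[\frac{\partial^2L}{\partial y^2}(x,y_u)-\varphi_u\frac{\partial^2a}{\partial y^2}(x,y_u)]z_{u,v_1}z_{u,v_2}\,dx-\int_\Omega[v_1z_{u,v_2}+v_2z_{u,v_1}]\varphi_u\,dx+\nu\int_\Omega v_1v_2\,dx$; $J''(u)v^2:=J''(u)(v,v)$. Sets associated with $(\bar u,\bar y,\bar\varphi)$ (conditions understood a.e. in $\Omega$; $|\cdot|$ of a set is Lebesgue measure): $\Sigma_{\bar u}=\{x\in\Omega:\bar u(x)\in\{\alpha,\beta\}\text{ and }\nu\bar u(x)-\bar y(x)\bar\varphi(x)=0\}$; $C_{\bar u}$ is the set of $v\in L^2(\Omega)$ with $v(x)=0$ if $\nu\bar u(x)-\bar y(x)\bar\varphi(x)\ne0$, $v(x)\ge0$ if $\bar u(x)=\alpha$, and $v(x)\le0$ if $\bar u(x)=\beta$; for $\tau\ge0$, $T^\tau_{\bar u}=\{v\in L^2(\Omega):v(x)=0\text{ if }|\nu\bar u(x)-\bar y(x)\bar\varphi(x)|>\tau\}$, and $T_{\bar u}=T^0_{\bar u}$. *)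

(* Defs.v *)
From HB Require Import structures.
From mathcomp Require Import all_boot all_order all_algebra.
From mathcomp Require Import all_classical all_reals all_analysis.
From mathcomp Require Import ess_sup_inf hoelder.

Set Implicit Arguments.
Unset Strict Implicit.
Unset Printing Implicit Defensive.
Import Order.TTheory GRing.Theory Num.Theory.
Import numFieldNormedType.Exports.

Local Open Scope classical_set_scope.
Local Open Scope ring_scope.

(* Copy of a type in which every set is measurable, so that the library's
   [mu_ext] ranges over arbitrary countable coverings. *)
Definition discrete_copy (T : Type) : Type := T.
HB.instance Definition _ (T : pointedType) :=
  Pointed.on (discrete_copy T).
HB.instance Definition _ (T : pointedType) :=
  @isMeasurable.Build default_measure_display (discrete_copy T)
    (@discrete_measurable T) (@discrete_measurable0 T)
    (@discrete_measurableC T) (@discrete_measurableU T).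

Section covering.
Context {R : realType} {T : pointedType}.
Implicit Types (w : set T -> \bar R) (X : set T).
Local Open Scope ereal_scope.

Definition cover_outer w X : \bar R :=
  ereal_inf [set \sum_(k <oo) w (F k)
            | F in [set F : (set T)^nat | X `<=` \bigcup_k F k]].

Lemma cover_outerE w X : cover_outer w X = @mu_ext _ (discrete_copy T) R w X.
Proof.
rewrite /cover_outer /mu_ext; congr ereal_inf; apply/seteqP; split => y /=.
  by move=> [F XF <-]; exists F => //; split.
by move=> [F [_ XF] <-]; exists F.
Qed.

Variable w : set T -> \bar R.
Hypotheses (w0 : w set0 = 0) (w_ge0 : forall X, 0 <= w X).

Lemma cover_outer0 : cover_outer w set0 = 0.
Proof. by rewrite cover_outerE; exact: mu_ext0. Qed.

Lemma cover_outer_ge0 X : 0 <= cover_outer w X.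
Proof. by rewrite cover_outerE; exact: mu_ext_ge0. Qed.

Lemma le_cover_outer : {homo cover_outer w : A B / A `<=` B >-> A <= B}.
Proof. by move=> A B AB; rewrite !cover_outerE; exact: le_mu_ext. Qed.

Lemma cover_outer_sigma_subadditive : sigma_subadditive (cover_outer w).
Proof.
move=> F; rewrite cover_outerE.
under eq_eseriesr do rewrite cover_outerE.
exact: mu_ext_sigma_subadditive.
Qed.

End covering.

Section euclidean_space.
Context {R : realType}.

Definition dotv {d} (x y : 'rV[R]_d) : R := \sum_(i < d) x 0 i * y 0 i.
(* The library norm on ['rV_d] is the sup norm; this is the Euclidean one. *)
Definition enorm {d} (x : 'rV[R]_d) : R := Num.sqrt (dotv x x).

Definition box {d} (a b : 'rV[R]_d) : set 'rV[R]_d :=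
  [set x | forall i, a 0 i <= x 0 i <= b 0 i].

(* Volume of the smallest box around [F], [+oo] if [F] is unbounded. *)
Definition box_weight {d} (F : set 'rV[R]_d) : \bar R :=
  if F == set0 then 0%E else
  ereal_inf [set (\prod_(i < d) (ab.2 0 i - ab.1 0 i))%:E
            | ab in [set ab : 'rV[R]_d * 'rV[R]_d | F `<=` box ab.1 ab.2]].

Definition lebesgue_outer (d : nat) : set 'rV[R]_d -> \bar R :=
  cover_outer box_weight.

Lemma box_weight0 d : @box_weight d set0 = 0%E.
Proof. by rewrite /box_weight eqxx. Qed.

Lemma box_weight_ge0 d (F : set 'rV[R]_d) : (0 <= box_weight F)%E.
Proof.
rewrite /box_weight; case: eqP => // /eqP/set0P[x Fx].
apply: le_ereal_inf_tmp => _ /= [[a b] /= Fab <-].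
rewrite lee_fin; apply: prodr_ge0 => i _.
by rewrite subr_ge0; have /andP[/le_trans] := Fab _ Fx i; exact.
Qed.

HB.instance Definition _ (d : nat) :=
  isOuterMeasure.Build R 'rV[R]_d (@lebesgue_outer d)
    (cover_outer0 (@box_weight0 d) (@box_weight_ge0 d))
    (cover_outer_ge0 (@box_weight_ge0 d))
    (le_cover_outer (@box_weight d))
    (cover_outer_sigma_subadditive (@box_weight_ge0 d)).

Definition lebesgue_outer_measure (d : nat) :
  {outer_measure set 'rV[R]_d -> \bar R} := @lebesgue_outer d.

(* R^d with the Lebesgue measurable sets. *)
Local Notation lebesgue_space d := (caratheodory_type (lebesgue_outer_measure d)).

Definition lebesgue (d : nat) : {measure set (lebesgue_space d) -> \bar R} :=
  (lebesgue_outer_measure d : set (lebesgue_space d) -> \bar R).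

Definition diameter {d} (F : set 'rV[R]_d) : \bar R :=
  ereal_sup [set (enorm (xy.1 - xy.2))%:E | xy in F `*` F].

(* Normalization making the [s]-dimensional Hausdorff measure agree with the
   [s]-dimensional surface measure: the volume of the Euclidean ball of
   diameter 1 in R^s. *)
Definition hausdorff_cst (s : nat) : R :=
  fine (@lebesgue_outer s [set x | enorm x <= 2^-1]).

Definition hausdorff_weight (s : nat) (delta : R) {d} (F : set 'rV[R]_d) :
    \bar R :=
  if F == set0 then 0%E else
  if (diameter F <= delta%:E)%E
  then ((hausdorff_cst s)%:E * diameter F ^+ s)%E else +oo%E.

Definition hausdorff_outer (s d : nat) (X : set 'rV[R]_d) : \bar R :=
  ereal_sup [set cover_outer (hausdorff_weight s delta) X
            | delta in [set delta : R | 0 < delta]].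

Section hausdorff_is_outer.
Variables s d : nat.
Local Open Scope ereal_scope.

Lemma hausdorff_weight0 delta : @hausdorff_weight s delta d set0 = 0.
Proof. by rewrite /hausdorff_weight eqxx. Qed.

Lemma hausdorff_weight_ge0 delta (F : set 'rV[R]_d) :
  0 <= hausdorff_weight s delta F.
Proof.
rewrite /hausdorff_weight; case: eqP => // /eqP/set0P[x Fx].
case: ifP => // _; apply: mule_ge0.
  by rewrite lee_fin fine_ge0//; exact: outer_measure_ge0.
apply: expe_ge0; apply: (le_trans _ (ereal_sup_ubound _)); last first.
  by exists (x, x).
by rewrite lee_fin sqrtr_ge0.
Qed.

Let c0 delta := cover_outer0 (hausdorff_weight0 delta)
  (hausdorff_weight_ge0 delta).

Lemma hausdorff_outer0 : @hausdorff_outer s d set0 = 0.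
Proof.
rewrite /hausdorff_outer (_ : [set _ | _ in _] = [set 0]) ?ereal_sup1//.
apply/seteqP; split => [_ [e _ <-]|_ ->] /=; first exact: c0.
by exists 1%R; [exact: ltr01|exact: c0].
Qed.

Lemma hausdorff_outer_ge0 (X : set 'rV[R]_d) : 0 <= hausdorff_outer s X.
Proof.
apply: (le_trans (cover_outer_ge0 (hausdorff_weight_ge0 1) X)).
by apply: ereal_sup_ubound; exists 1%R => //=; exact: ltr01.
Qed.

Lemma le_hausdorff_outer :
  {homo @hausdorff_outer s d : A B / A `<=` B >-> A <= B}.
Proof.
move=> A B AB; apply: ge_ereal_sup => _ [e e0 <-].
apply: (le_trans (le_cover_outer (hausdorff_weight s e) AB)).
by apply: ereal_sup_ubound; exists e.
Qed.

Lemma hausdorff_outer_sigma_subadditive :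
  sigma_subadditive (@hausdorff_outer s d).
Proof.
move=> F; apply: ge_ereal_sup => _ [e e0 <-].
apply: (le_trans (cover_outer_sigma_subadditive
  (hausdorff_weight_ge0 e) F)).
apply: lee_nneseries => [k _ _|k _].
  exact/cover_outer_ge0/hausdorff_weight_ge0.
by apply: ereal_sup_ubound; exists e.
Qed.

HB.instance Definition _ := isOuterMeasure.Build R 'rV[R]_d
  (@hausdorff_outer s d) hausdorff_outer0 hausdorff_outer_ge0
  le_hausdorff_outer hausdorff_outer_sigma_subadditive.

End hausdorff_is_outer.

Definition hausdorff_outer_measure (s d : nat) :
  {outer_measure set 'rV[R]_d -> \bar R} := @hausdorff_outer s d.

Local Notation surface_space d :=
  (caratheodory_type (hausdorff_outer_measure d.-1 d)).

Definition surface (d : nat) : {measure set (surface_space d) -> \bar R} :=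
  (hausdorff_outer_measure d.-1 d : set (surface_space d) -> \bar R).

(* The topological boundary, for open [Omega]. *)
Definition bdry {d} (Omega : set 'rV[R]_d) : set 'rV[R]_d :=
  closure Omega `\` Omega.

(* Near each boundary point, [Omega] is the strict epigraph, in some unit
   direction [e], of a Lipschitz function of the component orthogonal to [e]. *)
Definition lipschitz_boundary {d} (Omega : set 'rV[R]_d) : Prop :=
  forall x, bdry Omega x ->
  exists (r K : R) (e : 'rV[R]_d) (gam : 'rV[R]_d -> R),
    [/\ 0 < r, enorm e = 1,
        forall y z, `|gam y - gam z| <= K * enorm (y - z)
      & forall y, enorm (y - x) < r ->
          (Omega y <-> gam (y - dotv y e *: e) < dotv y e)].

Definition lipschitz_domain {d} (Omega : set 'rV[R]_d) : Prop :=
  [/\ Omega !=set0, open Omega, connected Omega, bounded_set Omega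
    & lipschitz_boundary Omega].

End euclidean_space.

Section Lp.
Context {disp} {X : measurableType disp} {R : realType}.
Variables (m : {measure set X -> \bar R}) (D : set X) (p : \bar R).

Definition Lpnorm (f : X -> R) : \bar R := Lnorm m p (EFin \o (f \_ D)).
Definition Lp : set (X -> R) :=
  [set f | measurable_fun D f /\ (Lpnorm f < +oo)%E].

End Lp.

(* Function spaces are handled through representatives: a space is given by a
   set [S] of functions and a seminorm [N], elements at distance 0 being
   identified. *)

Section frechet.
Context {R : realType} {X Y : lmodType R}.
Variables (SX : set X) (NX : X -> \bar R) (SY : set Y) (NY : Y -> \bar R).
Local Open Scope ereal_scope.

Definition bounded_linear_op (S : X -> Y) : Prop :=
  [/\ forall h, SX h -> SY (S h),
      forall c h k, SX h -> SX k ->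
        NY (S (c *: h + k)%R - (c *: S h + S k))%R = 0
    & exists C : R, forall h, SX h -> NY (S h) <= C%:E * NX h].

Definition bounded_bilinear_op (S : X -> X -> Y) : Prop :=
  [/\ forall h k, SX h -> SX k -> SY (S h k),
      forall c h1 h2 k, SX h1 -> SX h2 -> SX k ->
        NY (S (c *: h1 + h2) k - (c *: S h1 k + S h2 k))%R = 0,
      forall c h k1 k2, SX h -> SX k1 -> SX k2 ->
        NY (S h (c *: k1 + k2) - (c *: S h k1 + S h k2))%R = 0
    & exists C : R, forall h k, SX h -> SX k ->
        NY (S h k) <= C%:E * (NX h * NX k)].

(* [F], defined on the open subset [U] of [SX], is of class C^2 on [U] with
   first derivative [DF] and second derivative [D2F]; the last two clauses use
   the operator norms of linear and bilinear maps. *)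
Definition C2_on (U : set X) (F : X -> Y) (DF : X -> X -> Y)
    (D2F : X -> X -> X -> Y) : Prop :=
  forall u, U u ->
  [/\ bounded_linear_op (DF u), bounded_bilinear_op (D2F u),
      forall e : R, (0 < e)%R -> exists2 delta : R, (0 < delta)%R &
        forall h, SX h -> U (u + h)%R -> NX h < delta%:E ->
          NY (F (u + h) - F u - DF u h)%R <= e%:E * NX h,
      forall e : R, (0 < e)%R -> exists2 delta : R, (0 < delta)%R &
        forall h k, SX h -> SX k -> U (u + h)%R -> NX h < delta%:E ->
          NY (DF (u + h) k - DF u k - D2F u h k)%R <= e%:E * (NX h * NX k)
    & forall e : R, (0 < e)%R -> exists2 delta : R, (0 < delta)%R &
        forall w h k, U w -> SX h -> SX k -> NX (w - u)%R < delta%:E ->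
          NY (D2F w h k - D2F u h k)%R <= e%:E * (NX h * NX k)].

End frechet.

Section domain.
Context {R : realType} {d : nat}.
Local Notation Rd := 'rV[R]_d.
Local Notation leb := (@lebesgue R d).
Local Notation leb_space := (caratheodory_type (@lebesgue_outer_measure R d)).
Local Notation sig := (@surface R d).

Definition partial (i : 'I_d) (f : Rd -> R) : Rd -> R :=
  'D_(delta_mx 0 i : Rd) f.

Fixpoint C_ (k : nat) (f : Rd -> R) : Prop :=
  continuous f /\
  if k is k'.+1 then
    forall i, (forall x, derivable f x (delta_mx 0 i : Rd)) /\ C_ k' (partial i f)
  else True.

Definition smooth (f : Rd -> R) : Prop := forall k, C_ k f.

Definition grad (f : Rd -> R) (x : Rd) : Rd := \row_i partial i f x.

Definition test_function (Omega : set Rd) : set (Rd -> R) :=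
  [set psi | smooth psi /\
    exists K, [/\ compact K, K `<=` Omega & forall x, ~ K x -> psi x = 0]].

Variable Omega : set Rd.

Definition L2 : set (Rd -> R) := Lp leb Omega 2%:E.
Definition L2norm : (Rd -> R) -> \bar R := Lpnorm leb Omega 2%:E.

Definition weak_gradient (f : Rd -> R) (Df : Rd -> Rd) : Prop :=
  forall psi, test_function Omega psi -> forall i,
    \int[leb]_(x in Omega) (f x * partial i psi x) =
    - \int[leb]_(x in Omega) (Df x 0 i * psi x).

(* An element of H^1(Omega) is carried as the pair of the function and of its
   weak gradient, which the function determines almost everywhere. *)
Definition weak_fun : Type := ((Rd -> R) * (Rd -> Rd))%type.

Definition H1 : set weak_fun :=
  [set y : weak_fun | [/\ L2 y.1, forall i, L2 (fun x => y.2 x 0 i)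
             & weak_gradient y.1 y.2]].

Definition H1norm (y : weak_fun) : \bar R :=
  ((L2norm y.1 ^+ 2 + \sum_(i < d) L2norm (fun x => y.2 x 0%R i) ^+ 2)
     `^ 2^-1)%E.

Definition holder_norm (mu : R) (D : set Rd) (f : Rd -> R) : \bar R :=
  (ereal_sup [set `|f x|%:E | x in D] +
   ereal_sup [set (`|f xy.1 - f xy.2| / enorm (xy.1 - xy.2) `^ mu)%:E
             | xy in [set xy : Rd * Rd | [/\ D xy.1, D xy.2 & xy.1 != xy.2]]])%E.

(* H^1(Omega) \cap C^{0,mu}(closure Omega), the first component being the
   Holder continuous representative. *)
Definition H1C (mu : R) : set weak_fun :=
  [set y : weak_fun | H1 y /\ (holder_norm mu (closure Omega) y.1 < +oo)%E].

Definition H1Cnorm (mu : R) (y : weak_fun) : \bar R :=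
  (H1norm y + holder_norm mu (closure Omega) y.1)%E.

(* Trace on the boundary: limit in L^2 of the restrictions of smooth functions
   on R^d whose restrictions to [Omega] converge in H^1(Omega). *)
Definition is_trace (y : weak_fun) (t : Rd -> R) : Prop :=
  Lp sig (bdry Omega) 2%:E t /\
  exists psi : nat -> Rd -> R,
    [/\ forall n, smooth (psi n),
        H1norm ((psi n, grad (psi n)) - y) @[n --> \oo] --> 0%E
      & Lpnorm sig (bdry Omega) 2%:E (psi n - t) @[n --> \oo] --> 0%E].

Definition trace (y : weak_fun) : Rd -> R :=
  xget (fun=> 0) [set t | is_trace y t].

Definition elliptic (A : Rd -> 'M[R]_d) (MA LamA : R) : Prop :=
  [/\ forall i j, Lp leb Omega +oo%E (fun x => A x i j), 0 < MA, 0 < LamA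
    & {ae leb, forall x, Omega x -> forall xi : Rd,
        MA * dotv xi xi >= \sum_i \sum_j A x i j * xi 0 i * xi 0 j /\
        \sum_i \sum_j A x i j * xi 0 i * xi 0 j >= LamA * dotv xi xi}].

Definition adjoint_coef (A : Rd -> 'M[R]_d) : Rd -> 'M[R]_d :=
  fun x => (A x)^T.

(* [y] is a weak solution of
     - \sum_{i,j} d_j (B_{ij} d_i y) = f in Omega,   d_{n_B} y = h on bdry Omega *)
Definition weak_sol (B : Rd -> 'M[R]_d) (f h : Rd -> R) (y : weak_fun) : Prop :=
  H1 y /\ forall psi, H1 psi ->
    \int[leb]_(x in Omega)
        (\sum_i \sum_j B x i j * y.2 x 0 i * psi.2 x 0 j) =
    \int[leb]_(x in Omega) (f x * psi.1 x) +
    \int[sig]_(x in bdry Omega) (h x * trace psi x).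

(* Elliptic regularity for B y + y = f, d_{n_B} y = h: an element of H^1 being
   known up to null sets, its Holder continuous representative is [y']. *)
Definition holder_exponent (A : Rd -> 'M[R]_d) (p q : \bar R) (mu : R) : Prop :=
  0 < mu <= 1 /\
  exists C : R, forall B, B = A \/ B = adjoint_coef A ->
  forall f h y,
    Lp leb Omega (mine p 2%:E) f -> Lp sig (bdry Omega) q h ->
    weak_sol B (fun x => f x - y.1 x) h y ->
    exists y' : Rd -> R, {ae leb, forall x, Omega x -> y.1 x = y' x} /\
      (holder_norm mu (closure Omega) y' <=
       C%:E * (Lpnorm leb Omega (mine p 2%:E) f +
               Lpnorm sig (bdry Omega) q h))%E.

Definition dy (f : Rd -> R -> R) (x : Rd) : R -> R := derive1 (f x).
Definition dyy (f : Rd -> R -> R) (x : Rd) : R -> R := derive1n 2 (f x).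

Definition C2_caratheodory (f : Rd -> R -> R) : Prop :=
  (forall y, measurable_fun (Omega : set leb_space) (f ^~ y)) /\
  {ae leb, forall x, Omega x ->
     [/\ forall y, derivable (f x) y 1, forall y, derivable (dy f x) y 1
       & continuous (dyy f x)]}.

Definition unif_continuous_d2 (f : Rd -> R -> R) : Prop :=
  forall eps M : R, 0 < eps -> 0 < M -> exists2 rho : R, 0 < rho &
    {ae leb, forall x, Omega x -> forall y1 y2 : R,
       `|y1| <= M -> `|y2| <= M -> `|y1 - y2| <= rho ->
       `|dyy f x y1 - dyy f x y2| <= eps}.

Definition nonlinearity (p : \bar R) (a : Rd -> R -> R) (a0 : R) : Prop :=
  [/\ C2_caratheodory a,
      Lp leb Omega p (a ^~ 0),
      0 <= a0 /\
      {ae leb, forall x, Omega x -> forall y, a0 <= dy a x y},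
      forall M : R, 0 < M -> exists C : R,
        {ae leb, forall x, Omega x -> forall y : R, `|y| <= M ->
           `|dy a x y| + `|dyy a x y| <= C}
    & unif_continuous_d2 a].

Definition cost_integrand (p : \bar R) (L : Rd -> R -> R) : Prop :=
  [/\ C2_caratheodory L,
      Lp leb Omega 1%E (L ^~ 0),
      forall M : R, 0 < M -> exists2 LM : Rd -> R, Lp leb Omega p LM &
        {ae leb, forall x, Omega x -> forall y : R, `|y| <= M ->
           `|dy L x y| <= LM x},
      forall M : R, 0 < M -> exists C : R,
        {ae leb, forall x, Omega x -> forall y : R, `|y| <= M ->
           `|dyy L x y| <= C}
    & unif_continuous_d2 L].

Definition state_eq (A : Rd -> 'M[R]_d) (a : Rd -> R -> R) (g : Rd -> R)
    (u : Rd -> R) (y : weak_fun) : Prop :=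
  weak_sol A (fun x => - (a x (y.1 x) + u x * y.1 x)) g y.

Definition adjoint_eq (A : Rd -> 'M[R]_d) (a L : Rd -> R -> R)
    (u : Rd -> R) (y phi : weak_fun) : Prop :=
  weak_sol (adjoint_coef A)
    (fun x => dy L x (y.1 x) -
              (dy a x (y.1 x) * phi.1 x + u x * phi.1 x))
    (fun=> 0) phi.

Definition Uad (alpha : R) (beta : \bar R) : set (Rd -> R) :=
  [set u | L2 u /\
    {ae leb, forall x, Omega x -> (alpha%:E <= (u x)%:E <= beta)%E}].

Definition Proj (alpha : R) (beta : \bar R) (t : R) : \bar R :=
  mine beta (maxe alpha%:E t%:E).

(* The value +oo outside [Omega] makes this the essential infimum over [Omega]. *)
Definition m_ (u : Rd -> R) : \bar R :=
  ess_inf leb (patch (fun=> +oo%E) Omega (EFin \o u)).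

Definition Lam_ (LamA a0 : R) (u : Rd -> R) : \bar R :=
  mine LamA%:E (a0%:E + m_ u)%E.

Definition calA0 (a0 : R) : set (Rd -> R) :=
  [set u | L2 u /\ (0 < a0%:E + m_ u)%E].

Definition calA (a0 : R) (eps : (Rd -> R) -> R) : set (Rd -> R) :=
  [set u | L2 u /\
    exists2 ub, calA0 a0 ub & (L2norm (u - ub)%R < (eps ub)%:E)%E].

(* [C4] is a constant of the embedding of H^1(Omega) in L^4(Omega); the radii
   [eps] are those for which the control-to-state map [G] is well defined and of
   class C^2 on [calA]. *)
Definition control_to_state (A : Rd -> 'M[R]_d) (LamA : R)
    (a : Rd -> R -> R) (a0 : R) (g : Rd -> R) (mu C4 : R)
    (eps : (Rd -> R) -> R) (G : (Rd -> R) -> weak_fun) : Prop :=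
  [/\ forall y, H1 y -> (Lpnorm leb Omega 4%:E y.1 <= C4%:E * H1norm y)%E,
      forall ub, calA0 a0 ub ->
        0 < eps ub /\ ((eps ub)%:E < Lam_ LamA a0 ub * (C4 ^- 2)%:E)%E,
      forall u, calA a0 eps u ->
        [/\ H1C mu (G u), state_eq A a g u (G u)
          & forall y, H1C mu y -> state_eq A a g u y ->
              {ae leb, forall x, Omega x -> y.1 x = (G u).1 x}]
    & exists DG D2G,
        C2_on L2 L2norm (H1C mu) (H1Cnorm mu) (calA a0 eps) G DG D2G].

Definition J (L : Rd -> R -> R) (nu : R) (G : (Rd -> R) -> weak_fun)
    (u : Rd -> R) : R :=
  (\int[leb]_(x in Omega) (L x ((G u).1 x))) +
  nu / 2 * \int[leb]_(x in Omega) (u x ^+ 2).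

Section sets.
Variables (alpha : R) (beta : \bar R) (nu : R) (u y phi : Rd -> R).

Definition dJ (x : Rd) : R := nu * u x - y x * phi x.

Definition Sigma_ : set Rd :=
  [set x | [/\ Omega x, u x = alpha \/ (u x)%:E = beta & dJ x = 0]].

Definition critical_cone : set (Rd -> R) :=
  [set v | L2 v /\
    {ae leb, forall x, Omega x ->
       [/\ dJ x <> 0 -> v x = 0, u x = alpha -> 0 <= v x
         & (u x)%:E = beta -> v x <= 0]}].

Definition T_ (tau : R) : set (Rd -> R) :=
  [set v | L2 v /\
    {ae leb, forall x, Omega x -> tau < `|dJ x| -> v x = 0}].

End sets.

End domain.

(* Main.v *)
Require Import Defs.
From mathcomp Require Import all_boot all_order all_algebra.
From mathcomp Require Import all_classical all_reals all_analysis.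
From mathcomp Require Import measurable_realfun ess_sup_inf hoelder.
From mathcomp Require Import ring lra.
Import Order.TTheory GRing.Theory Num.Theory.
Import numFieldNormedType.Exports.
Local Open Scope classical_set_scope.
Local Open Scope ring_scope.

(** The second derivative of [G] is not needed.  Testing the state equation for
    [u + t v] with the adjoint state and the adjoint equation with the states
    [y_(u + t v)] and [y_u] gives
      [J (u + t v) - J u = t * l v + nu / 2 * t^2 * |v|^2 + O(s^2 + t * s * |v|)]
    with [s = sup |y_(u + t v) - y_u|].  Symmetric second differences turn this
    into the Garding inequality
      [J''(u) v^2 >= nu * |v|^2 - C * (s^2 + s * |v|)],  [s = sup |G'(u) v|],
    and [G'(u)] is compact from L^2 to C^0 because it is bounded into
    C^(0,mu).

    If no [T^tau] admits a coercivity constant, the infima of [J''(u) v^2] over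
    the unit spheres of [T^(1/(k+1))] increase to a limit [<= 0].  The
    parallelogram identity and the Garding inequality make a subsequence of
    near-minimizers strongly Cauchy in L^2; its limit is a unit vector [v] of
    [T^0 = C_u] with [J''(u) v^2 <= 0], a contradiction.  This replaces the
    usual argument by weak compactness and weak lower semicontinuity. *)

Set Implicit Arguments.
Unset Strict Implicit.
Unset Printing Implicit Defensive.

(** * Coercivity of positive forms *)

(** [D2J] is known only through [C2_on], as a second derivative of [J], and no integral formula for
    it is assumed. Lower bounds on it are therefore read off from values of [J]; in a symmetric
    second difference the linear coefficient cancels.

    The term [nu / 2 * t^2 * |v|^2] is exact, being the quadratic part of the control cost. All
    other second-order contributions contain the state increment, and the cross term [t * s * |v|]
    comes from the product of control and state. Hence the Garding defect vanishes when the
    linearized states tend to 0 uniformly.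

    For two near-minimizers [h], [k] in one subspace, [h + k] stays there, so its form value is at
    least the infimum times [|h + k|^2]. The parallelogram identity then leaves almost nothing
    positive for [h - k], and the Garding inequality makes it short. This requires the linear spaces
    [T^tau]: [C_u] is by definition only a cone, and strict complementarity is what identifies it
    with their intersection. *)

Section coercivity.
Context {R : realType} {V : lmodType R}.
Variables (S : nat -> set V) (N : V -> R) (B : V -> V -> R).
(* [small h s] stands for [P h <= s], with [P] a seminorm for which the unit
   sphere of [N] is precompact. *)
Variables (small : V -> R -> Prop) (nu C M : R).
Hypothesis nu0 : 0 < nu.
Hypothesis C0 : 0 <= C.
Hypothesis S_lin : forall n c h k, S n h -> S n k -> S n (c *: h + k).
Hypothesis S_decr : forall m n, (m <= n)%N -> S n `<=` S m.
Hypothesis N_ge0 : forall h, 0 <= N h.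
Hypothesis NZ : forall c h, S 0 h -> N (c *: h) = `|c| * N h.
Hypothesis ND : forall h k, S 0 h -> S 0 k -> N (h + k) <= N h + N k.
Hypothesis N_par : forall h k, S 0 h -> S 0 k ->
  N (h + k) ^+ 2 + N (h - k) ^+ 2 = 2 * (N h ^+ 2 + N k ^+ 2).
Hypothesis Bl : forall c h1 h2 k, S 0 h1 -> S 0 h2 -> S 0 k ->
  B (c *: h1 + h2) k = c * B h1 k + B h2 k.
Hypothesis Br : forall c h k1 k2, S 0 h -> S 0 k1 -> S 0 k2 ->
  B h (c *: k1 + k2) = c * B h k1 + B h k2.
Hypothesis B_le : forall h k, S 0 h -> S 0 k -> `|B h k| <= M * (N h * N k).
Hypothesis garding : forall h s, S 0 h -> 0 <= s -> small h s ->
  nu * N h ^+ 2 - C * (s ^+ 2 + s * N h) <= B h h.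
Hypothesis small_compact : forall v : nat -> V, (forall k,
  S 0 (v k) /\ N (v k) = 1) ->
  exists f : nat -> nat, (forall k, (k <= f k)%N) /\
  forall e, 0 < e -> exists n, forall k l, (n <= k)%N -> (n <= l)%N ->
    small (v (f k) - v (f l)) e.
Hypothesis complete : forall v : nat -> V, (forall k, S 0 (v k)) ->
  (forall e, 0 < e -> exists n, forall k l, (n <= k)%N -> (n <= l)%N ->
    N (v k - v l) < e) ->
  exists w, (forall n, (forall k, (n <= k)%N -> S n (v k)) -> S n w) /\
    forall e, 0 < e -> exists n, forall k, (n <= k)%N -> N (v k - w) < e.
Hypothesis B_pos : forall h, (forall n, S n h) -> N h <> 0 -> 0 < B h h.

Let S0 n h : S n h -> S 0 h. Proof. exact: S_decr. Qed.
Let SD n h k : S n h -> S n k -> S n (h + k).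
Proof. by move=> ? ?; rewrite -[h]scale1r; exact: S_lin. Qed.
Let SB n h k : S n h -> S n k -> S n (h - k).
Proof. by move=> ? ?; rewrite addrC -scaleN1r; exact: S_lin. Qed.
Let SZ n c h : S n h -> S n (c *: h).
Proof. by move=> Sh; rewrite -[c *: h]addr0 -(subrr h); apply: S_lin => //;
  exact: SB. Qed.

(** Bilinearity suffices: the form is not assumed symmetric. *)
Let B_par h k : S 0 h -> S 0 k ->
  B (h + k) (h + k) + B (h - k) (h - k) = 2 * (B h h + B k k).
Proof.
move=> Sh Sk; have Sp := SD Sh Sk; have Sm := SB Sh Sk.
have := Bl 1 Sh Sk Sp; have := Bl (-1) Sk Sh Sm.
have := Br 1 Sh Sh Sk; have := Br 1 Sk Sh Sk.
have := Br (-1) Sh Sk Sh; have := Br (-1) Sk Sk Sh.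
rewrite !scale1r !scaleN1r !(addrC (- k) h) => -> -> -> -> -> ->.
by ring.
Qed.

Let BZ c h : S 0 h -> B (c *: h) (c *: h) = c ^+ 2 * B h h.
Proof.
move=> Sh; have Z := SZ c Sh; have O : S 0 0 by rewrite -(subrr h); exact: SB.
have z0 : B 0 (c *: h) = 0.
  by have := Bl 1 O O Z; rewrite scaler0 addr0 mul1r => /eqP;
    rewrite -subr_eq0 opprD addNKr oppr_eq0 => /eqP.
have z1 : B h 0 = 0.
  by have := Br 1 Sh O O; rewrite scaler0 addr0 mul1r => /eqP;
    rewrite -subr_eq0 opprD addNKr oppr_eq0 => /eqP.
have := Bl c Sh O Z; have := Br c Sh Sh O.
by rewrite !addr0 z0 z1 !addr0 => -> ->; ring.
Qed.

(** The hypothesis [complete] also encodes closedness: it puts the limit in each [S n] that contains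
    the terms of index at least [n]. This is how a limit of near-minimizers taken from shrinking
    spaces reaches the intersection, where [B_pos] applies. *)
Lemma coercive_of_positive :
  exists n kappa, 0 < kappa /\ forall h, S n h -> kappa * N h ^+ 2 <= B h h.
Proof.
apply: contrapT => nocoer.
(* Failure of coercivity, normalized. A violating [h] has [N h != 0], because [B_le] gives
   [B h h = 0] when [N h = 0]. *)
have unit n (kappa : R) : 0 < kappa -> exists h, [/\ S n h,
  N h = 1 & B h h < kappa].
  move=> k0; apply: contrapT => nh; apply: nocoer; exists n, kappa; split=> // h Sh.
  rewrite leNgt; apply/negP => lt; apply: nh.
  have Sh0 := S0 Sh.
  have N0 : N h != 0.
    apply/eqP => Nh0; have := B_le Sh0 Sh0; rewrite Nh0 !mulr0 normr_le0 => /eqP Bh.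
    by move: lt; rewrite Nh0 Bh expr0n mulr0 ltxx.
  exists ((N h)^-1 *: h); split.
  - exact: SZ.
  - by rewrite NZ// ger0_norm ?invr_ge0// mulVf.
  - rewrite BZ// exprVn mulrC ltr_pdivrMr// exprn_gt0//.
    by rewrite lt_neqAle eq_sym N0 N_ge0.
pose E n := [set B h h | h in [set h | S n h /\ N h = 1]].
have E_lb n : lbound (E n) (- M).
  move=> _ [h [Sh Nh] <-]; have := B_le (S0 Sh) (S0 Sh).
  by rewrite Nh !mulr1 ler_norml => /andP[].
have E_inf n : has_inf (E n).
  split; last by exists (- M).
  by have [h [Sh Nh _]] := unit n 1 ltr01; exists (B h h), h.
pose lam n := inf (E n).
have lam_le n h : S n h -> lam n * N h ^+ 2 <= B h h.
  move=> Sh; have [Nh|Nh] := eqVneq (N h) 0.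
    have := B_le (S0 Sh) (S0 Sh); rewrite Nh expr0n !mulr0 normr_le0 => /eqP ->.
    by [].
  have Np : 0 < N h by rewrite lt_neqAle eq_sym Nh N_ge0.
  rewrite -ler_pdivlMr ?exprn_gt0// mulrC -exprVn -BZ; last exact: S0 Sh.
  apply: ge_inf; first by exists (- M).
  exists ((N h)^-1 *: h) => //; split; first exact: SZ.
  by rewrite NZ ?ger0_norm ?invr_ge0 ?mulVf//; exact: S0 Sh.
have lam0 n : lam n <= 0.
  apply/ler_addgt0Pr => e e0; rewrite add0r.
  have [h [Sh Nh /ltW]] := unit n _ e0; apply: le_trans.
  by have := lam_le n h Sh; rewrite Nh expr1n mulr1.
have lam_nd m n : (m <= n)%N -> lam m <= lam n.
  move=> mn; apply: lb_le_inf; first by have [] := E_inf n.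
  move=> _ [h [Sh Nh] <-].
  by have := lam_le m h (S_decr mn Sh); rewrite Nh expr1n mulr1.
have /choice[v hv] n : exists h, [/\ S n h, N h = 1 & B h h < lam n + n.+1%:R^-1].
  have n0 : 0 < n.+1%:R^-1 :> R by rewrite invr_gt0.
  by have [_ [h [Sh Nh] <-] ?] := inf_adherent n0 (E_inf n); exists h.
have hv0 k : S 0 (v k) /\ N (v k) = 1 by have [/S0] := hv k.
have [f [fk fsmall]] := small_compact hv0.
have sup_lam : has_sup (range lam).
  by split; [exists (lam 0%N), 0%N|exists 0 => _ [n _ <-]].
have lam_sup n : lam n <= sup (range lam).
  by apply: ub_le_sup; [case: sup_lam|exists n].
have inv_lt (e : R) : 0 < e -> exists n, n.+1%:R^-1 < e.
  move=> e0; exists (Num.truncn e^-1).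
  rewrite invf_plt ?posrE//.
  by rewrite truncnS_gt.
have inv_le k n : (n <= k)%N -> k.+1%:R^-1 <= n.+1%:R^-1 :> R.
  by move=> nk; rewrite lef_pV2 ?posrE// ler_nat ltnS.
have [w [Sw vw]] : exists w, (forall n, (forall k, (n <= k)%N ->
  S n (v (f k))) -> S n w) /\
    forall e, 0 < e -> exists n, forall k, (n <= k)%N -> N (v (f k) - w) < e.
  apply: complete => [k|e e0]; first by have [] := hv0 (f k).
  (* Budget: near-minimality and the parallelogram identity give [BD < 8 * eta], the Garding defect
     costs at most [4 * eta], and [16 * eta = nu * e ^+ 2] leaves room. *)
  pose eta := nu * e ^+ 2 / 16.
  have eta0 : 0 < eta by rewrite !mulr_gt0// ?exprn_gt0// invr_gt0.
  have [n1 n1P] := inv_lt _ eta0.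
  have [_ [n2 _ <-] n2P] := sup_adherent eta0 sup_lam.
  have [s [s0 sC]] : exists s, 0 < s /\ C * (s ^+ 2 + s * 2) <= 4 * eta.
    have d0 : 0 < C + 1 by rewrite ltr_wpDl.
    (* Since [s <= 1], [s ^+ 2 <= s] and the defect is at most [3 * C * s <= 3 * eta]. The factor 2
       bounds the norm of a difference of unit vectors. *)
    pose s := Num.min 1 (eta / (C + 1)).
    have s0 : 0 < s by rewrite lt_min ltr01 divr_gt0.
    exists s; split => //.
    have s1 : s <= 1 by rewrite ge_min lexx.
    have : s * (C + 1) <= eta by rewrite -ler_pdivlMr// ge_min lexx orbT.
    have : s ^+ 2 <= s by rewrite expr2 ler_piMr// ltW.
    move=> sq sl; have Cs := ler_wpM2l C0 sq.
    by have := mulr_ge0 C0 (ltW s0); nra.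
  have [n3 n3P] := fsmall _ s0.
  pose n := maxn n1 n2; exists (maxn n n3) => k l; rewrite !(@geq_max _ n n3).
  move=> /andP[nk n3k] /andP[nl n3l].
  have nfk := leq_trans nk (fk k); have nfl := leq_trans nl (fk l).
  have [Sk Nk Bk] := hv (f k); have [Sl Nl Bl'] := hv (f l).
  have Skn := S_decr nfk Sk; have Sln := S_decr nfl Sl.
  have := B_par (S0 Sk) (S0 Sl); have := N_par (S0 Sk) (S0 Sl).
  have := lam_le _ _ (SD Skn Sln).
  have := garding (S0 (SB Skn Sln)) (ltW s0) (n3P _ _ n3k n3l).
  have N2 : N (v (f k) - v (f l)) <= 2.
    have SlN := SZ (-1) (S0 Sl).
    have := ND (S0 Sk) SlN; rewrite NZ; last exact: S0 Sl.
    by rewrite normrN1 mul1r scaleN1r Nk Nl.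
  have := N_ge0 (v (f k) - v (f l)).
  move: N2; rewrite Nk Nl expr1n.
  set D := N (_ - _); set P := N (_ + _); set BD := B (_ - _) _; set BP :=
    B (_ + _) _.
  move=> D2 D0 gd lP NP BPD.
  have lk := lam_sup (f k); have ll := lam_sup (f l).
  have ik := le_lt_trans (inv_le _ _ (leq_trans (leq_maxl n1 n2) nfk)) n1P.
  have il := le_lt_trans (inv_le _ _ (leq_trans (leq_maxl n1 n2) nfl)) n1P.
  have ln := lam_nd _ _ (leq_maxr n1 n2); rewrite -/n in ln.
  (* As [lam n] is nonpositive, the part in [D] of [lam n * (4 - D ^+ 2)] only improves the lower
     bound on [BP]. *)
  have lD : lam n * D ^+ 2 <= 0 by rewrite mulr_le0_ge0// sqr_ge0.
  have P2 : P ^+ 2 = 4 - D ^+ 2 by rewrite -[P ^+ 2](addrK (D ^+ 2)) NP; ring.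
  rewrite P2 mulrBr in lP.
  have CD : C * (s ^+ 2 + s * D) <= 4 * eta.
    apply: le_trans sC; rewrite ler_wpM2l// lerD2l.
    by rewrite ler_wpM2l// ltW.
  have : nu * D ^+ 2 < 16 * eta.
    move: gd lP BPD lk ll ik il ln lD CD n2P Bk Bl'.
    move: (nu * _) (C * _) (_^-1) (_^-1) (sup _) (lam n * D ^+ 2) (lam n) (lam
      n2) (lam (f k)) (lam (f l)) (B _ _) (B _ _).
    move=> *; lra.
  rewrite /eta mulrC [16 * _]mulrC divfK ?pnatr_eq0// [ltRHS]mulrC ltr_pM2r//.
  by rewrite ltr_pXn2r// ?nnegrE// ltW.
have {}Sw n : S n w.
  by apply: Sw => k nk; apply: S_decr (leq_trans nk (fk k)) _ _; have [] :=
    hv (f k).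
have near (e : R) : 0 < e -> exists k, [/\ N (v k - w) < e,
  N (w - v k) = N (v k - w) & k.+1%:R^-1 < e].
  move=> e0; have [n1 h1] := vw _ e0; have [n2 h2] := inv_lt _ e0.
  exists (f (maxn n1 n2)); split; first by apply: h1; exact: leq_maxl.
    have := NZ (-1) (SB (hv0 (f (maxn n1 n2))).1 (Sw 0%N)).
    by rewrite normrN1 mul1r scaleN1r opprB.
  by apply: le_lt_trans h2; apply: inv_le; apply: leq_trans (fk _); exact: leq_maxr.
have Nw : N w = 1.
  apply/eqP; rewrite eq_le; apply/andP; split; apply/ler_addgt0Pr => e e0.
    have [k [ke ks _]] := near _ e0; have [Sk Nk] := hv0 k.
    have := ND Sk (SB (Sw 0) Sk); rewrite addrC subrK ks Nk => /le_trans; apply.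
    by rewrite lerD2l ltW.
  have [k [ke _ _]] := near _ e0; have [Sk Nk] := hv0 k.
  have := ND (Sw 0) (SB Sk (Sw 0)); rewrite addrC subrK Nk => /le_trans; apply.
  by rewrite lerD2l ltW.
have : 0 < B w w by apply: B_pos => //; rewrite Nw; apply/eqP; exact: oner_neq0.
apply/negP; rewrite -leNgt.
have M0 : 0 <= M by have := B_le (Sw 0) (Sw 0); rewrite Nw !mulr1; apply: le_trans.
apply/ler_addgt0Pr => e e0; rewrite add0r.
(* In [B w w = B (w - v k) w + B (v k) (w - v k) + B (v k) (v k)] the first two terms are at most
   [M] times the distance and the last is below [k.+1%:R^-1], which accounts for the factor
   [1 + M * 2]. *)
have d0 : 0 < 1 + M * 2 by rewrite ltr_pwDl// mulr_ge0.
have [k [ke ks kn]] := near _ (divr_gt0 e0 d0); have [Sk Nk Bk] := hv k.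
have SD0 := SB (Sw 0) (S0 Sk).
have := Bl 1 SD0 (S0 Sk) (Sw 0); have := Br 1 (S0 Sk) SD0 (S0 Sk).
rewrite !scale1r !subrK !mul1r => -> ->.
have := B_le SD0 (Sw 0); have := B_le (S0 Sk) SD0.
rewrite Nw Nk ks mul1r mulr1 =>
  /(le_trans (ler_norm _)) b1 /(le_trans (ler_norm _)) b2.
have lk := lam0 k.
set D := N (v k - w) in ke b1 b2 *; set q := e / _ in ke kn.
have := ler_wpM2l M0 (ltW ke).
have : q * (1 + M * 2) = e by rewrite /q divfK// gt_eqF.
clearbody q; clear ke; move: b1 b2 Bk kn lk;
  move: (M * D) (B _ _) (B _ _) (B _ _) (lam k) (k.+1%:R^-1)  => *; lra.
Qed.

End coercivity.

(** * Lebesgue measurability of open sets *)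

Section lebesgue_space.
Context {R : realType} {d : nat}.
Implicit Types (F X : set 'rV[R]_d) (i : 'I_d) (c : R).

Lemma box_weight_le F a b : F `<=` box a b -> F !=set0 ->
  (box_weight F <= (\prod_(i < d) (b 0 i - a 0 i))%:E)%E.
Proof.
move=> Fab /set0P F0; rewrite /box_weight (negbTE F0).
by apply: ereal_inf_lbound; exists (a, b).
Qed.

(** The hyperplane [x_i = c] cuts a box around [F] into two boxes that differ from it only in side
    [i], and the two side lengths add up. An empty piece is treated apart: then [c] may lie outside
    the box, and the product for that piece could be negative. *)
Lemma box_weight_halfspace F i c :
  (box_weight (F `&` [set x | (x 0 i < c)%R]) +
   box_weight (F `&` ~` [set x | (x 0 i < c)%R]) <= box_weight F)%E.
Proof.
set H := [set x | _].
have [->|F0] := eqVneq F set0; first by rewrite !set0I box_weight0 adde0.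
rewrite {3}/box_weight (negbTE F0).
apply: le_ereal_inf_tmp => _ /= [[a b] /= Fab <-].
have [->|/set0P FH0] := eqVneq (F `&` H) set0.
  rewrite box_weight0 add0e.
  have [->|/set0P FH1] := eqVneq (F `&` ~` H) set0.
    rewrite box_weight0 lee_fin; move/set0P : F0 => [x Fx].
    apply: prodr_ge0 => j _; rewrite subr_ge0.
    by have /andP[/le_trans] := Fab _ Fx j; exact.
  by apply: box_weight_le => // x [/Fab].
have [->|/set0P FH1] := eqVneq (F `&` ~` H) set0.
  by rewrite box_weight0 adde0; apply: box_weight_le => // x [/Fab].
have E (e : 'rV[R]_d) j :
  (\row_k (if k == i then c else e 0 k)) 0 j = if j == i then c else e 0 j.
  by rewrite mxE.
apply: (@le_trans _ _ ((\prod_(j < d) ((\row_k (if k == i then c else b 0 k)) 0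
  j - a 0 j))%:E
  + (\prod_(j < d) (b 0 j - (\row_k (if k == i then c else a 0 k)) 0 j))%:E)%E).
  apply: leeD; apply: box_weight_le => //.
    move=> x [/Fab abx Hx] j; rewrite E; have /andP[-> xb] /= := abx j.
    by case: eqP => // ->; exact: ltW.
  move=> x [/Fab abx Hx] j; rewrite E; have /andP[ax ->] /= := abx j.
  by rewrite andbT; case: eqP => // ->; move/negP : Hx; rewrite -leNgt.
have D (f : 'I_d -> R) : \prod_j f j = f i * \prod_(j | j != i) f j.
  by rewrite (bigD1 i).
rewrite -EFinD lee_fin !D !E eqxx.
rewrite (_ : \prod_(j | j != i) _ = \prod_(j | j != i) (b 0 j - a 0 j)); last first.
  by apply: eq_bigr => j ji; rewrite E (negbTE ji).
rewrite (_ : \prod_(j | j != i) (b 0 j - _ 0 j) = \prod_(j | j != i) (b 0 j - a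
  0 j)); last first.
  by apply: eq_bigr => j ji; rewrite E (negbTE ji).
by rewrite -mulrDl addrC subrKA.
Qed.

(** Each set of a covering is cut by the hyperplane; the pieces cover the two parts of [X], and
    their weights add up to at most the weight of the set. *)
Lemma measurable_halfspace i c : (@lebesgue_outer_measure R d).-cara.-measurable
  [set x | x 0 i < c].
Proof.
set H := [set x | _].
apply: le_caratheodory_measurable => X.
apply: le_ereal_inf_tmp => _ /= [F XF <-].
apply: (@le_trans _ _ (\sum_(k <oo) box_weight (F k `&` H) +
                       \sum_(k <oo) box_weight (F k `&` ~` H)))%E.
  apply: leeD; apply: ereal_inf_lbound => /=.
    by exists (fun k => F k `&` H) => //; rewrite -setI_bigcupl; exact: setSI.
  by exists (fun k => F k `&` ~` H) => //; rewrite -setI_bigcupl; exact: setSI.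
rewrite -nneseriesD; [|by move=> *; exact: box_weight_ge0..].
apply: lee_nneseries => k _ *; last exact: box_weight_halfspace.
by rewrite adde_ge0// box_weight_ge0.
Qed.

(** An open set is the union of the countably many rational half-open boxes that it contains; the
    other boxes are replaced by the empty set. *)
Lemma measurable_open (O : set 'rV[R]_d) : open O ->
  (@lebesgue_outer_measure R d).-cara.-measurable O.
Proof.
move=> oO.
pose B (q : 'rV[rat]_d * 'rV[rat]_d) : set 'rV[R]_d :=
  [set x | forall i, ratr (q.1 0 i) <= x 0 i < ratr (q.2 0 i)].
have mB q : (@lebesgue_outer_measure R d).-cara.-measurable (B q).
  rewrite (_ : B q = \bigcap_(i in [set: 'I_d]) (~` [set x : 'rV[R]_d | x 0 i <
    ratr (q.1 0 i)]
      `&` [set x | x 0 i < ratr (q.2 0 i)])).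
    apply: fin_bigcap_measurable => // i _.
    by apply: measurableI; [apply: measurableC|]; exact: measurable_halfspace.
  apply/seteqP; split => [x qx i _ /=|x qx i].
    by have /andP[q1 ->] := qx i; split => //; apply/negP; rewrite -leNgt.
  by have [/negP] := qx i I; rewrite -leNgt => -> /= ->.
pose Q q := if `[< B q `<=` O >] then B q else set0.
rewrite (_ : O = \bigcup_q Q q); last first.
  apply/seteqP; split => [x Ox|x [q _]]; last first.
    by rewrite /Q; case: asboolP => // + Bq; exact.
  have /nbhs_ballP[e /= e0 xeO] : nbhs x O by exact: open_nbhs_nbhs.
  have /choice[r hr] (i : 'I_d) : exists r : rat, ratr r \in `]x 0 i - e, x 0 i[.
    by apply: rat_in_itvoo; rewrite ltrBlDr ltrDl.
  have /choice[s hs] (i : 'I_d) : exists s : rat, ratr s \in `]x 0 i, x 0 i + e[.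
    by apply: rat_in_itvoo; rewrite ltrDl.
  exists (\row_i r i, \row_i s i) => //; rewrite /Q asboolT.
    move=> i /=; rewrite !mxE.
    by move: (hr i) (hs i); rewrite !in_itv/= => /andP[_ /ltW ->] /andP[-> _].
  move=> y By; apply: xeO; split=> // j i; rewrite ord1.
  rewrite /ball/=; move: (By i) (hr i) (hs i); rewrite /= !mxE !in_itv/=.
  move=> /andP[y1 y2] /andP[y3 y4] /andP[y5 y6].
  by rewrite ltr_distlC; apply/andP; split; lra.
apply: countable_bigcupT_measurable => [|q].
  exact: countableP.
by rewrite /Q; case: asboolP => // _; exact: mB.
Qed.

Lemma lebesgue_bounded (O : set 'rV[R]_d) : bounded_set O ->
  (@lebesgue R d O < +oo)%E.
Proof.
move=> /pinfty_ex_gt0[M M0 OM].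
rewrite /lebesgue /= /lebesgue_outer.
have [->|/set0P O0] := eqVneq O set0;
  first by rewrite (cover_outer0 (@box_weight0 R d) (@box_weight_ge0 R d)).
apply: (@le_lt_trans _ _ (box_weight O)); last first.
  apply: le_lt_trans (ltry _).
  apply: (@box_weight_le _ (\row_i (- M)) (\row_i M)) => // x Ox i; rewrite !mxE.
  rewrite -ler_norml; apply: le_trans (OM _ Ox).
  by rewrite [leRHS]mx_normrE; apply: (le_bigmax _ (fun ij =>
    `|x ij.1 ij.2|) (0, i)).
have F0 : box_weight (@set0 'rV[R]_d) = 0%E by exact: box_weight0.
apply: le_trans (ereal_inf_lbound _) _.
  by exists (fun k : nat => if k == 0%N then O else set0) => //= x Ox; exists 0%N.
rewrite (@nneseriesD1 _ _ 0%N)//; last by move=> k _; exact: box_weight_ge0.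
by rewrite eseries0 ?adde0// => -[|k].
Qed.

End lebesgue_space.

(** * Functions on a complete measure space *)

Section complete_measure.
Context {disp} {X : measurableType disp} {R : realType}.
Variables (m : {measure set X -> \bar R}) (D : set X).
Hypothesis cm : measure_is_complete m.
Hypothesis mD : measurable D.

Lemma ae_eq_measurable_fun (f g : X -> R) :
  {ae m, forall x, D x -> f x = g x} -> measurable_fun D f -> measurable_fun D g.
Proof.
move=> fg mf; apply/measurable_EFinP.
apply: (ae_measurable_fun cm _ (f := EFin \o f)); last exact/measurable_EFinP.
by apply: filterS fg => x + Dx => /(_ Dx) /= ->.
Qed.

(** The limsup of the sequence is measurable whatever happens on the exceptional set, and
    completeness allows it to be replaced by [f]. *)
Lemma ae_cvg_measurable_fun (f_ : nat -> X -> R) (f : X -> R) :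
  (forall n, measurable_fun D (f_ n)) ->
  {ae m, forall x, D x -> f_ n x @[n --> \oo] --> f x} -> measurable_fun D f.
Proof.
move=> mf ff; pose g x := limn_esup (fun n => (f_ n x)%:E).
have mg : measurable_fun D g.
  by apply: measurable_fun_limn_esup => n; exact/measurable_EFinP.
apply/measurable_EFinP; apply: (ae_measurable_fun cm _ mg).
apply: filterS ff => x + Dx => /(_ Dx) h /=.
have /cvg_limn_einf_sup[_ <-] : (f_ n x)%:E @[n --> \oo] --> (f x)%:E.
  by apply: cvg_EFin; [exact: nearW|exact: h].
by [].
Qed.

(** [y] is rounded down to multiples of [n.+1%:R^-1]. On each of the countably many level sets the
    composite is [f] at a fixed second argument, and continuity in that argument gives the limit. *)
Lemma measurable_fun_comp_caratheodory (f : X -> R -> R) (y : X -> R) :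
  (forall s, measurable_fun D (f ^~ s)) ->
  {ae m, forall x, D x -> continuous (f x)} -> measurable_fun D y ->
  measurable_fun D (fun x => f x (y x)).
Proof.
move=> mf cf my.
pose k (n : nat) x : int := Num.floor (y x * n.+1%:R).
apply: (@ae_cvg_measurable_fun (fun n x => f x ((k n x)%:~R / n.+1%:R)));
  last first.
  apply: filterS cf => x + Dx => /(_ Dx) cfx.
  apply: (cvg_comp (fun n => (k n x)%:~R / n.+1%:R)); last exact: cfx.
  have h0 : n.+1%:R^-1 @[n --> \oo] --> (0 : R) by exact: cvg_harmonic.
  apply/cvgrPdist_le => e e0; near=> n.
  have : n.+1%:R^-1 < e :> R by near: n; exact: (cvgr_lt _ h0).
  have n0 : 0 < n.+1%:R :> R by [].
  have /andP[k1 k2] := floor_itv (y x * n.+1%:R); rewrite -/(k n x) in k1 k2.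
  move=> ne; rewrite ger0_norm; last by rewrite subr_ge0 ler_pdivrMr.
  apply/ltW; apply: le_lt_trans ne; rewrite lerBlDl .
  have -> : (k n x)%:~R / n.+1%:R + n.+1%:R^-1 = ((k n x)%:~R + 1) / n.+1%:R :> R.
    by rewrite mulrDl mul1r.
  rewrite ler_pdivlMr//.
  by move: k2; rewrite intrD => /ltW.
move=> n _ Y mY.
rewrite (_ : _ `&` _ = \bigcup_(j : int)
   ((D `&` y @^-1` `[j%:~R / n.+1%:R, (j + 1)%:~R / n.+1%:R[) `&`
    (D `&` (f ^~ (j%:~R / n.+1%:R)) @^-1` Y))).
  apply: countable_bigcupT_measurable => [|j]; first exact: countableP.
  apply: measurableI; first exact: my.
  exact: mf.
have jk j x : (y @^-1` `[j%:~R / n.+1%:R, (j + 1)%:~R / n.+1%:R[) x <-> k n x = j.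
  rewrite /= in_itv/= ler_pdivrMr// ltr_pdivlMr// /k; split=> [|<-].
    exact: floor_def.
  by rewrite floor_itv.
apply/seteqP; split => [x [Dx /= Yx]|x [j _ [[Dx /jk kj] [_ Yx]]]].
  by exists (k n x) => //; split => //; split => //; exact/jk.
by split => //=; rewrite kj.
Unshelve. all: by end_near.
Qed.

(** The derivative is a limit of difference quotients with step [n.+1%:R^-1], each of which is
    measurable by the previous lemma. *)
Lemma measurable_fun_derive1_comp (f : X -> R -> R) (y : X -> R) :
  (forall s, measurable_fun D (f ^~ s)) ->
  {ae m, forall x, D x -> forall s, derivable (f x) s 1} -> measurable_fun D y ->
  measurable_fun D (fun x => derive1 (f x) (y x)).
Proof.
move=> mf df my.
have cf : {ae m, forall x, D x -> continuous (f x)}.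
  apply: filterS df => x + Dx s => /(_ Dx s).
  by move/derivable1_diffP/differentiable_continuous.
apply: (@ae_cvg_measurable_fun
  (fun n x => n.+1%:R * (f x (n.+1%:R^-1 + y x) - f x (y x)))).
  move=> n; apply: measurable_funM => //; apply: measurable_funB.
    apply: measurable_fun_comp_caratheodory => //.
    by apply: measurable_funD.
  exact: measurable_fun_comp_caratheodory.
apply: filterS df => x + Dx => /(_ Dx (y x)) dfx.
have h0 : n.+1%:R^-1 @[n --> \oo] --> (0 : R)^'.
  move=> A /= A0; have [N _ hN] := @cvg_harmonic R _ A0.
  by exists N => // n Nn; apply: hN Nn _; exact: lt0r_neq0 (harmonic_gt0 n).
have := cvg_comp _ _ h0 dfx.
under eq_cvg do rewrite /= invrK scaler1.
by rewrite derive1E.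
Qed.

Lemma ae_le_integrable (f g : X -> R) : measurable_fun D f ->
  {ae m, forall x, D x -> `|f x| <= g x} -> m.-integrable D (EFin \o g) ->
  m.-integrable D (EFin \o f).
Proof.
move=> mf fg /integrableP[mg ig]; apply/integrableP; split.
  exact/measurable_EFinP.
apply: le_lt_trans ig; apply: ae_ge0_le_integral => //.
- by apply: measurableT_comp => //; exact/measurable_EFinP.
- by apply: measurableT_comp.
- apply: filterS fg => x + Dx => /(_ Dx) /= h; rewrite lee_fin.
  exact: le_trans h (ler_norm _).
Qed.

Hypothesis mDoo : (m D < +oo)%E.

Lemma integrable_cstr (c : R) : m.-integrable D (EFin \o (fun=> c)).
Proof.
apply/integrableP; split; first exact/measurable_EFinP.
rewrite /= (_ : (fun=> _) = cst `|c|%:E)// integral_cst//.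
by rewrite lte_mul_pinfty.
Qed.

Lemma ae_bounded_integrable (f : X -> R) (c : R) : measurable_fun D f ->
  {ae m, forall x, D x -> `|f x| <= c} -> m.-integrable D (EFin \o f).
Proof. by move=> mf fc; exact: ae_le_integrable mf fc (integrable_cstr c). Qed.

Lemma ae_eq_Rintegral (f g : X -> R) : measurable_fun D f ->
  {ae m, forall x, D x -> f x = g x} ->
  \int[m]_(x in D) f x = \int[m]_(x in D) g x.
Proof.
move=> mf fg; rewrite /Rintegral; congr fine; apply: ae_eq_integral => //.
- exact/measurable_EFinP.
- by apply/measurable_EFinP; exact: ae_eq_measurable_fun fg mf.
- by apply: filterS fg => x + Dx => /(_ Dx) ->.
Qed.

Lemma ae_le_norm_Rintegral (f g : X -> R) : measurable_fun D f ->
  {ae m, forall x, D x -> `|f x| <= g x} -> m.-integrable D (EFin \o g) ->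
  `|\int[m]_(x in D) f x| <= \int[m]_(x in D) g x.
Proof.
move=> mf fg ig; have iff := ae_le_integrable mf fg ig.
apply: le_trans (le_normr_Rintegral mD iff) _.
have ia : m.-integrable D (EFin \o (fun x => `|f x|)).
  apply: ae_le_integrable ig; first exact: measurableT_comp.
  by apply: filterS fg => x + Dx => /(_ Dx); rewrite normr_id.
rewrite /Rintegral; apply: fine_le; [exact: integrable_fin_num..|].
have mg : measurable_fun D g by apply/measurable_EFinP; exact: measurable_int ig.
(* This maximum equals [g] almost everywhere and dominates [f] everywhere, so the pointwise
   comparison of integrals applies. *)
have mM : measurable_fun D (fun x => (Num.max (g x) `|f x|)%:E).
  by apply/measurable_EFinP; apply: measurable_maxr => //; exact: measurableT_comp.
have E : (\int[m]_(x in D) (g x)%:E = \int[m]_(x in D) (Num.max (g x) `|f x|)%:E)%E.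
  apply: ae_eq_integral => //.
  - exact/measurable_EFinP.
  - by apply: filterS fg => x + Dx => /(_ Dx) /max_l ->.
rewrite E; apply: ge0_le_integral => //.
- by apply/measurable_EFinP; exact: measurableT_comp.
- by move=> x _; rewrite lee_fin le_max lexx orbT.
Qed.

End complete_measure.

(** * Square integrable functions *)

Section square_integrable.
Context {disp} {X : measurableType disp} {R : realType}.
Variables (m : {measure set X -> \bar R}) (D : set X).
Hypothesis mD : measurable D.
Local Notation L2 := (Lp m D 2%:E).
Local Notation N f := (fine (Lpnorm m D 2%:E f)).

Lemma Lpnorm2E (f : X -> R) :
  Lpnorm m D 2%:E f = ((\int[m]_(x in D) (f x ^+ 2)%:E) `^ 2^-1)%E.
Proof.
rewrite /Lpnorm unlock /= [in RHS]integral_mkcond; congr (_ `^ _)%E.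
apply: eq_integral => x _; rewrite /= /patch; case: ifPn => _.
  by rewrite powR_mulrn// real_normK// num_real.
by rewrite normr0 powR0.
Qed.

Let sq_ge0 (f : X -> R) : (0 <= \int[m]_(x in D) (f x ^+ 2)%:E)%E.
Proof. by apply: integral_ge0 => x _; rewrite lee_fin sqr_ge0. Qed.

Lemma L2P (f : X -> R) :
  L2 f <-> measurable_fun D f /\ m.-integrable D (EFin \o (fun x => f x ^+ 2)).
Proof.
rewrite /Lp /= Lpnorm2E; split=> -[mf].
  move/lty_poweRy => oo; have {}oo := oo (invr_neq0 (lt0r_neq0 (ltr0n R 2))).
  split=> //; apply/integrableP; split.
    by apply/measurable_EFinP; exact: measurable_funX.
  by under eq_integral do rewrite /= ger0_norm ?sqr_ge0//; exact: oo.
move=> /integrableP[_]; under eq_integral do rewrite /= ger0_norm ?sqr_ge0//.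
by move=> oo; split=> //; exact: poweR_lty.
Qed.

Lemma L2_measurable (f : X -> R) : L2 f -> measurable_fun D f.
Proof. by case. Qed.

Lemma L2norm_fin_num (f : X -> R) : L2 f -> (N f)%:E = Lpnorm m D 2%:E f.
Proof. by move=> [_ oo]; rewrite fineK// ge0_fin_numE// Lnorm_ge0. Qed.

Lemma L2norm_ge0 (f : X -> R) : 0 <= N f.
Proof. by rewrite fine_ge0// Lnorm_ge0. Qed.

Lemma L2norm_sqr (f : X -> R) : L2 f -> N f ^+ 2 = \int[m]_(x in D) (f x ^+ 2).
Proof.
move=> /L2P[_ sf]; rewrite Lpnorm2E /Rintegral.
have fi : (\int[m]_(x in D) (f x ^+ 2)%:E)%E \is a fin_num by exact:
  integrable_fin_num.
rewrite -[in LHS](fineK fi) poweR_EFin/=.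
by rewrite powR12_sqrt ?fine_ge0// sqr_sqrtr// fine_ge0.
Qed.

Lemma L2_mul_integrable (f g : X -> R) : L2 f -> L2 g ->
  m.-integrable D (EFin \o (fun x => f x * g x)).
Proof.
move=> /L2P[mf sf] /L2P[mg sg].
apply: le_integrable (integrableD mD sf sg) => //.
  by apply/measurable_EFinP; exact: measurable_funM.
move=> x _ /=; rewrite lee_fin.
rewrite [leRHS]ger0_norm ?addr_ge0 ?sqr_ge0// normrM.
rewrite -(real_normK (num_real (f x))) -(real_normK (num_real (g x))).
have := sqr_ge0 (`|f x| - `|g x|); have := normr_ge0 (f x); have := normr_ge0 (g x).
by nra.
Qed.

Lemma L2_linear (c : R) (f g : X -> R) : L2 f -> L2 g -> L2 (c *: f + g).
Proof.
move=> Lf Lg; have fg := L2_mul_integrable Lf Lg.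
move: Lf Lg => /L2P[mf sf] /L2P[mg sg].
apply/L2P; split.
  by apply: measurable_funD => //; exact: measurable_funM.
have := integrableD mD (integrableZl mD (c ^+ 2) sf)
  (integrableD mD (integrableZl mD (c *+ 2) fg) sg).
apply: eq_integrable => // x _ /=; rewrite -!EFinM -!EFinD; congr EFin.
by rewrite (_ : (c *: f + g) x = c * f x + g x)//; ring.
Qed.

Lemma L2_sub (f g : X -> R) : L2 f -> L2 g -> L2 (f - g).
Proof. by move=> Lf Lg; rewrite addrC -scaleN1r; exact: L2_linear. Qed.

Lemma L2_add (f g : X -> R) : L2 f -> L2 g -> L2 (f + g).
Proof. by move=> Lf Lg; rewrite -[f]scale1r; exact: L2_linear. Qed.

Lemma L2_scale (c : R) (f : X -> R) : L2 f -> L2 (c *: f).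
Proof. by move=> Lf; rewrite -[c *: f]addr0 -(subrr f); apply: L2_linear => //;
  exact: L2_sub. Qed.

Lemma L2norm_sqrD (c : R) (f g : X -> R) : L2 f -> L2 g ->
  N (c *: f + g) ^+ 2 = c ^+ 2 * N f ^+ 2 + c * 2 * \int[m]_(x in D) (f x * g x)
    + N g ^+ 2.
Proof.
move=> Lf Lg; have fg := L2_mul_integrable Lf Lg.
rewrite (L2norm_sqr (L2_linear c Lf Lg)) !L2norm_sqr//.
move: (Lf) (Lg) => /L2P[mf sf] /L2P[mg sg].
rewrite -!RintegralZl//.
have i1 : m.-integrable D (EFin \o (fun x =>
  c ^+ 2 * f x ^+ 2)) by exact: (integrableZl mD (c ^+ 2) sf).
have i2 : m.-integrable D (EFin \o (fun x =>
  c * 2 * (f x * g x))) by exact: (integrableZl mD (c * 2) fg).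
rewrite -!RintegralD//; last exact: (integrableD mD i1 i2).
by apply: eq_Rintegral => x _; rewrite (_ : (c *: f + g) x = c * f x + g x)//; ring.
Qed.

Lemma L2norm_parallelogram (f g : X -> R) : L2 f -> L2 g ->
  N (f + g) ^+ 2 + N (f - g) ^+ 2 = 2 * (N f ^+ 2 + N g ^+ 2).
Proof.
move=> Lf Lg; have := L2norm_sqrD 1 Lf Lg; have := L2norm_sqrD (-1) Lg Lf.
rewrite scale1r scaleN1r addrC => -> ->.
by under eq_Rintegral do rewrite mulrC; ring.
Qed.

Lemma L2norm_scale (c : R) (f : X -> R) : L2 f -> N (c *: f) = `|c| * N f.
Proof.
move=> Lf; apply/eqP.
rewrite -(@eqrXn2 _ 2)// ?mulr_ge0// ?L2norm_ge0//; apply/eqP.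
rewrite exprMn real_normK ?num_real// !L2norm_sqr//; last exact: L2_scale.
have /L2P[_ sf] := Lf.
by rewrite -RintegralZl//; apply: eq_Rintegral => x _;
  rewrite (_ : (c *: f) x = c * f x)// exprMn.
Qed.

Lemma L2norm_CauchySchwarz (f g : X -> R) : L2 f -> L2 g ->
  `|\int[m]_(x in D) (f x * g x)| <= N f * N g.
Proof.
move=> Lf Lg; set I := \int[m]_(x in D) _.
have q (c : R) : 0 <= c ^+ 2 * N f ^+ 2 + c * 2 * I + N g ^+ 2.
  by rewrite -L2norm_sqrD// sqr_ge0.
have f0 := L2norm_ge0 f; have g0 := L2norm_ge0 g.
rewrite -(@ler_pXn2r _ 2)// ?nnegrE ?mulr_ge0// real_normK ?num_real//.
have [Nf|Nf] := eqVneq (N f) 0.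
  have [I0|I0] := eqVneq I 0; first by rewrite I0 expr0n sqr_ge0.
  (* Here the quadratic is affine in [c] with nonzero slope, and this [c] gives it the value -1. *)
  have := q (- (N g ^+ 2 + 1) / (2 * I)); rewrite Nf expr0n /= mulr0 add0r.
  have -> : - (N g ^+ 2 + 1) / (2 * I) * 2 * I = - (N g ^+ 2 + 1) by field.
  by rewrite opprD addrAC addNr add0r oppr_ge0 leNgt ltr01.
(* The minimizer of the quadratic in [c]. *)
have := q (- I / N f ^+ 2).
have -> : (- I / N f ^+ 2) ^+ 2 * N f ^+ 2 + - I / N f ^+ 2 * 2 * I + N g ^+ 2 =
  N g ^+ 2 - I ^+ 2 / N f ^+ 2 by field.
rewrite subr_ge0 ler_pdivrMr ?exprn_gt0 ?lt_neqAle ?(eq_sym 0) ?Nf//.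
by rewrite exprMn [X in _ <= X]mulrC.
Qed.

Lemma L2norm_triangle (f g : X -> R) : L2 f -> L2 g -> N (f + g) <= N f + N g.
Proof.
move=> Lf Lg; have f0 := L2norm_ge0 f; have g0 := L2norm_ge0 g.
rewrite -(@ler_pXn2r _ 2)// ?nnegrE ?addr_ge0 ?L2norm_ge0//.
rewrite -{1}[f]scale1r L2norm_sqrD//.
have := L2norm_CauchySchwarz Lf Lg => /(le_trans (ler_norm _)).
by move: (\int[m]_(x in D) _) (N f) (N g) => *; nra.
Qed.

End square_integrable.

(** * Completeness of L^2 on a set of finite measure *)

Section complete_L2.
Context {disp} {X : measurableType disp} {R : realType}.
Variables (m : {measure set X -> \bar R}) (D : set X).
Hypothesis cm : measure_is_complete m.
Hypothesis mD : measurable D.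
Hypothesis mDoo : (m D < +oo)%E.
Local Notation L2 := (Lp m D 2%:E).
Local Notation N f := (fine (Lpnorm m D 2%:E f)).

Lemma L2_bounded (f : X -> R) (c : R) : measurable_fun D f ->
  {ae m, forall x, D x -> `|f x| <= c} -> L2 f.
Proof.
move=> mf fc; apply/L2P => //; split=> //.
apply: (ae_bounded_integrable mD mDoo (c := c ^+ 2)).
  exact: measurable_funX.
apply: filterS fc => x + Dx => /(_ Dx) fc; rewrite normrX.
by rewrite lerXn2r// nnegrE// (le_trans _ fc).
Qed.

Lemma L2_cst (c : R) : L2 (fun=> c).
Proof. by apply: (@L2_bounded _ `|c|) => //; apply: nearW => x _. Qed.

Lemma L2_abs (f : X -> R) : L2 f -> L2 (fun x => `|f x|).
Proof.
move=> /L2P[mf sf]; apply/L2P => //; split; first exact: measurableT_comp.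
by apply: eq_integrable sf => // x _ /=; rewrite real_normK ?num_real.
Qed.

Lemma L2norm_abs (f : X -> R) : L2 f -> N (fun x => `|f x|) = N f.
Proof.
move=> Lf; apply/eqP; rewrite -(@eqrXn2 _ 2) ?L2norm_ge0//; apply/eqP.
rewrite !L2norm_sqr//; last exact: L2_abs.
by apply: eq_Rintegral => x _; rewrite real_normK ?num_real.
Qed.

Lemma L1_le_L2 (f : X -> R) : L2 f ->
  \int[m]_(x in D) `|f x| <= N f * N (fun=> 1).
Proof.
move=> Lf; rewrite -(L2norm_abs Lf); apply: le_trans (ler_norm _) _.
have := L2norm_CauchySchwarz mD (L2_abs Lf) (L2_cst 1).
by under eq_Rintegral do rewrite mulr1.
Qed.

Lemma L2_integrable (f : X -> R) : L2 f -> m.-integrable D (EFin \o f).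
Proof.
move=> Lf; apply: eq_integrable (L2_mul_integrable mD Lf (L2_cst 1)) => // x _ /=.
by rewrite mulr1.
Qed.

(** On a set of finite measure the L^2 norm controls the L^1 norm, so the increments have finite
    total integral. Their sum is then finite almost everywhere, and the telescoping series converges
    absolutely there. *)
Lemma L2_ae_cvg (v : nat -> X -> R) : (forall k, L2 (v k)) ->
  (forall k, N (v k.+1 - v k) <= (2 ^- k)) ->
  {ae m, forall x, D x -> cvgn (fun k => v k x)}.
Proof.
move=> Lv vv; pose h k x := `|v k.+1 x - v k x|%:E.
have Ld k : L2 (v k.+1 - v k) by exact: L2_sub.
have mh k : measurable_fun D (h k).
  apply/measurable_EFinP; apply: measurableT_comp => //.
  exact: L2_measurable (Ld k).
have h0 k x : D x -> (0 <= h k x)%E by rewrite lee_fin.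
have S : (\int[m]_(x in D) (\sum_(k <oo) h k x) < +oo)%E.
  rewrite integral_nneseries//.
  apply: (@le_lt_trans _ _ (\sum_(k <oo) ((2 ^- k) * N (fun=> 1))%:E)%E).
    apply: lee_nneseries => [k _ _|k _]; first by apply: integral_ge0 => x;
      exact: h0.
    have ia := L2_integrable (L2_abs (Ld k)).
    rewrite -[leLHS](fineK (integrable_fin_num mD ia)) lee_fin.
    apply: le_trans (L1_le_L2 (Ld k)) _.
    by rewrite ler_wpM2r// L2norm_ge0.
  apply: (@le_lt_trans _ _ (2 * N (fun=> 1))%:E); last exact: ltry.
  apply: lime_le.
    by apply: is_cvg_nneseries => k _ _;
      rewrite lee_fin mulr_ge0 ?invr_ge0 ?exprn_ge0// L2norm_ge0.
  apply: nearW => n; rewrite sumEFin lee_fin -mulr_suml ler_wpM2r ?L2norm_ge0//.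
  have -> : \sum_(0 <= k < n) 2 ^- k = 2 - 2 * 2 ^- n :> R.
    elim: n => [|n IH]; first by rewrite big_geq// expr0 invr1; ring.
    by rewrite big_nat_recr//= IH exprS; field; rewrite expf_neq0.
  by rewrite gerBl mulr_ge0// invr_ge0 exprn_ge0.
have mS : measurable_fun D (fun x => \sum_(k <oo) h k x)%E.
  by apply: ge0_emeasurable_sum => // k x Dx _; exact: h0.
have iS : m.-integrable D (fun x => \sum_(k <oo) h k x)%E.
  apply/integrableP; split=> //; apply: le_lt_trans S.
  apply: ge0_le_integral => //.
  - exact: measurableT_comp.
  - by move=> x Dx; rewrite gee0_abs// nneseries_ge0// => n _ _; exact: h0.
apply: filterS (integrable_ae mD iS) => x + Dx => /(_ Dx) fS.
have : cvgn (series (fun k => v k.+1 x - v k x)).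
  apply: normed_cvg; apply: nondecreasing_is_cvgn.
    by apply/nondecreasing_seqP => n; rewrite -subr_ge0 seriesSB/=.
  exists (fine (\sum_(k <oo) h k x)%E) => _ [n _ <-].
  rewrite -lee_fin fineK// /series/= -sumEFin.
  by apply: nneseries_lim_ge => k _ _; exact: h0.
move=> cs; apply/cvg_ex; exists (v 0%N x + limn (series (fun k =>
  v k.+1 x - v k x))).
rewrite (_ : (fun k => v k x) = (fun n => v 0%N x + series (fun k =>
  v k.+1 x - v k x) n)).
  by apply: cvgD => //; exact: cvg_cst.
by apply/funext => n; rewrite /series/= telescope_sumr// addrC subrK.
Qed.

(** Riesz-Fischer. The almost everywhere convergent subsequence is part of the conclusion because
    the conditions defining [T_] are pointwise and pass to the limit through it. *)
Lemma L2_complete (v : nat -> X -> R) : (forall k, L2 (v k)) ->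
  (forall e, 0 < e -> exists n, forall k l, (n <= k)%N -> (n <= l)%N ->
    N (v k - v l) < e) ->
  exists w, [/\ L2 w,
    exists f : nat -> nat, (forall k, (k <= f k)%N) /\
     {ae m, forall x, D x -> v (f k) x @[k --> \oo] --> w x} &
    forall e, 0 < e -> exists n, forall k, (n <= k)%N -> N (v k - w) < e].
Proof.
move=> Lv Cv.
have /choice[g gP] k : exists n, forall i j, (n <= i)%N -> (n <= j)%N ->
    N (v i - v j) < 2 ^- k.
  by apply: Cv; rewrite invr_gt0 exprn_gt0.
(* Adding [k] to the sum of all thresholds up to [k] makes [f] nondecreasing, at least [k] and at
   least [g k], without a recursive choice. *)
pose f k := (k + \sum_(i < k.+1) g i)%N.
have kf k : (k <= f k)%N by exact: leq_addr.
have gf k : (g k <= f k)%N.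
  by rewrite /f big_ord_recr /= addnA leq_addl.
have fS k : (f k <= f k.+1)%N.
  by rewrite /f [in leqRHS]big_ord_recr /= addSn addnA; apply: leqW;
    exact: leq_addr.
have cvf : {ae m, forall x, D x -> cvgn (fun k => v (f k) x)}.
  apply: L2_ae_cvg => // k; apply/ltW/gP => //.
  exact: leq_trans (fS k).
pose w (x : X) : R := limn (fun k => v (f k) x).
have cw : {ae m, forall x, D x -> v (f k) x @[k --> \oo] --> w x}.
  by apply: filterS cvf => x h Dx; exact: h Dx.
have mw : measurable_fun D w.
  apply: (ae_cvg_measurable_fun cm _ cw) => n.
  exact: L2_measurable (Lv (f n)).
have est e : 0 < e -> exists n, forall i, (n <= i)%N ->
    (\int[m]_(x in D) ((v i x - w x) ^+ 2)%:E <= (e ^+ 2)%:E)%E.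
  move=> e0; have [n nP] := Cv e e0; exists n => i ni.
  have mi k : measurable_fun D (fun x => ((v i x - v (f k) x) ^+ 2)%:E).
    apply/measurable_EFinP; apply: measurable_funX; apply: measurable_funB.
      exact: L2_measurable (Lv i).
    exact: L2_measurable (Lv (f k)).
  have mw2 : measurable_fun D (fun x => ((v i x - w x) ^+ 2)%:E).
    apply/measurable_EFinP; apply: measurable_funX; apply: measurable_funB => //.
    exact: L2_measurable (Lv i).
  (* Fatou's lemma is applied with [i] fixed while the subsequence index tends to infinity, so the
     estimate holds for the whole sequence. *)
  have E : ae_eq m D (fun x => ((v i x - w x) ^+ 2)%:E)
      (fun x => limn_einf (fun k => ((v i x - v (f k) x) ^+ 2)%:E)).
    apply: filterS cw => x + Dx => /(_ Dx) c.
    have /cvg_limn_einf_sup[-> _//] : ((v i x - v (f k) x) ^+ 2)%:E @[k --> \oo]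
      --> ((v i x - w x) ^+ 2)%:E.
    apply: cvg_EFin; first exact: nearW.
    rewrite /comp/= !expr2; apply: cvgM; (apply: cvgB; [exact: cvg_cst|exact: c]).
  rewrite (ae_eq_integral _ _ mD mw2 (ae_measurable_fun cm E mw2) E).
  apply: le_trans (fatou m mD mi _) _; first by move=> k x _;
    rewrite lee_fin sqr_ge0.
  rewrite limn_einf_lim; apply: lime_le; first exact: is_cvg_einfs.
  exists n => // k /= nk; apply: le_trans (ereal_inf_lbound _) _;
    first by exists k => /=.
  have Ld := L2_sub mD (Lv i) (Lv (f k)).
  have /L2P[_ sd] := Ld.
  rewrite -[leLHS](fineK (integrable_fin_num mD sd)) lee_fin.
  rewrite [leLHS](_ : _ = N (v i - v (f k)) ^+ 2); last by rewrite L2norm_sqr.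
  rewrite lerXn2r ?nnegrE ?L2norm_ge0// ?ltW//; apply: nP => //.
  exact: leq_trans nk (kf k).
have Lw i (e : R) : (\int[m]_(x in D) ((v i x - w x) ^+ 2)%:E <= (e ^+ 2)%:E)%E
  -> L2 (v i - w).
  move=> le; apply/L2P => //; split.
    by apply: measurable_funB => //; exact: L2_measurable (Lv i).
  apply/integrableP; split.
    apply/measurable_EFinP/measurable_funX/measurable_funB => //.
    exact: L2_measurable (Lv i).
  apply: le_lt_trans (ltry (e ^+ 2)); apply: le_trans le.
  by under eq_integral do rewrite /= ger0_norm ?sqr_ge0//.
exists w; split.
- have [n /(_ n (leqnn _)) /Lw Ln] := est 1 ltr01.
  by rewrite -(subKr (v n) w); exact: L2_sub.
- by exists f.
move=> e e0; have [n nP] := est _ (divr_gt0 e0 (ltr0n R 2)); exists n => i /nP le.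
have Li := Lw _ _ le; apply: (@le_lt_trans _ _ (e / 2));
  last by rewrite ltr_pdivrMr// ltr_pMr// ltr1n.
rewrite -(@ler_pXn2r _ 2)// ?nnegrE ?L2norm_ge0 ?divr_ge0 ?(ltW e0)// L2norm_sqr//.
have /L2P[_ sd] := Li.
rewrite -lee_fin /Rintegral fineK; first exact: le.
exact: (integrable_fin_num mD sd).
Qed.

End complete_L2.

Section Lp_integrable.
Context {disp} {X : measurableType disp} {R : realType}.
Variables (m : {measure set X -> \bar R}) (D : set X).
Hypothesis mD : measurable D.
Hypothesis mDoo : (m D < +oo)%E.

(** For finite exponent [r >= 1], the absolute value of [f] is at most 1 plus its power [r], and
    constants are integrable on [D]. *)
Lemma Lp_integrable (p : \bar R) (f : X -> R) : (1 <= p)%E -> Lp m D p f ->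
  m.-integrable D (EFin \o f).
Proof.
move=> p1 [mf]; rewrite /Lpnorm; case: p p1 => [r| |//].
- rewrite lee_fin => r1 foo.
  have r0 : 0 < r by exact: lt_le_trans r1.
  have mp : measurable_fun D (fun x => `|f x| `^ r).
    apply: (@measurableT_comp _ _ _ _ _ _ (@powR R ^~ r)) => //.
    exact: measurableT_comp.
  have ip : m.-integrable D (EFin \o (fun x => `|f x| `^ r)).
    apply/integrableP; split; first exact/measurable_EFinP.
    move: foo; rewrite unlock /= => /lty_poweRy foo.
    have {}foo := foo (invr_neq0 (lt0r_neq0 r0)).
    rewrite (le_lt_trans _ foo)// integral_mkcond.
    apply: ge0_le_integral => //.
    + by move=> x _; apply: erestrict_ge0 => y Dy.
    + apply/(measurable_restrictT _ _).1 => //.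
      by apply/measurable_EFinP; exact: measurableT_comp.
    + apply/measurable_EFinP.
      apply: (@measurableT_comp _ _ _ _ _ _ (@powR R ^~ r)) => //.
      by apply: measurableT_comp => //; exact/(measurable_restrictT _ _).1.
    + move=> x _; rewrite /patch; case: ifPn => _ /=.
        by rewrite ger0_norm ?powR_ge0.
      by rewrite lee_fin powR_ge0.
  apply: (ae_le_integrable mD (g := fun x => 1 + `|f x| `^ r)) => //.
    apply: nearW => x _; have [f1|f1] := leP `|f x| 1.
      by rewrite (le_trans f1)// lerDl powR_ge0.
    apply: (@le_trans _ _ (`|f x| `^ r)); last by rewrite lerDr.
    by rewrite -[leLHS]powRr1// ler_powR// ltW.
  by have := integrableD mD (integrable_cstr mD mDoo 1) ip.
- move=> _; rewrite unlock /=; case: ifPn => [_ /ess_supr_bounded[M fM]|m0 _].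
    apply: (ae_bounded_integrable mD mDoo (c := M)) => //.
    by apply: filterS fM => x /= + Dx; rewrite patchE mem_set.
  (* In this branch of the definition of the norm the whole space has measure 0, so any bound holds
     almost everywhere. *)
  apply: (ae_bounded_integrable mD mDoo (c := 0)) => //.
  exists setT; split => //; apply/eqP.
  by rewrite eq_le measure_ge0 andbT leNgt.
Qed.

End Lp_integrable.

(** * Mean value estimates *)

Section mean_value.
Context {R : realType}.

Lemma mean_value_le (f df : R -> R) (y z K : R) :
  (forall w, Num.min y z <= w <= Num.max y z -> is_derive w 1 f (df w)) ->
  (forall w, Num.min y z <= w <= Num.max y z -> `|df w| <= K) ->
  `|f z - f y| <= K * `|z - y|.
Proof.
wlog yz : y z / y <= z.
  move=> h dfP K_; have [/h|/ltW zy] := leP y z; first exact.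
  by rewrite distrC (distrC z); apply: h => // w; rewrite minC maxC;
    [exact: dfP|exact: K_].
rewrite (min_idPl _)// (max_idPr _)// => dfP K_.
have fc : {within `[y, z], continuous f}.
  apply: derivable_within_continuous => w; rewrite in_itv/= => /dfP wP.
  exact: (@ex_derive _ _ _ _ _ _ _ wP).
have [w|c] := MVT_segment yz (df := df) _ fc.
  by rewrite in_itv/= => /andP[/ltW yw /ltW wz]; apply: dfP; rewrite yw.
rewrite in_itv/= => /K_ cK ->.
by rewrite normrM ler_wpM2r.
Qed.

(** The mean value inequality is used twice, on [derive1 f] and then on [f] minus its linear part at
    [y]. This yields [C] instead of [C / 2], which is enough for an error term. *)
Lemma taylor1_le (f : R -> R) (y z C M : R) :
  (forall w, derivable f w 1) -> (forall w, derivable (derive1 f) w 1) ->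
  (forall w, `|w| <= M -> `|derive1n 2 f w| <= C) -> `|y| <= M -> `|z| <= M ->
  `|f z - f y - derive1 f y * (z - y)| <= C * (z - y) ^+ 2.
Proof.
move=> df ddf fC yM zM.
have inM a b w : `|a| <= M -> `|b| <= M -> Num.min a b <= w <= Num.max a b ->
  `|w| <= M.
  rewrite !ler_norml => /andP[a1 a2] /andP[b1 b2] /andP[w1 w2]; apply/andP; split.
    by apply: le_trans w1; rewrite le_min a1.
  by apply: le_trans w2 _; rewrite ge_max a2.
have C0 : 0 <= C by apply: le_trans (fC y yM).
have lip w : Num.min y z <= w <= Num.max y z ->
  `|derive1 f w - derive1 f y| <= C * `|z - y|.
  move=> wyz; have wM := inM _ _ _ yM zM wyz.
  have wy : `|w - y| <= `|z - y|.
    move: wyz => /andP[]; have [yz|zy] := leP y z => yw wz.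
      by rewrite !ger0_norm ?subr_ge0// lerD2r.
    by rewrite !ler0_norm ?subr_le0 ?(ltW zy)// lerN2 lerD2r.
  apply: le_trans (ler_wpM2l C0 wy).
  apply: (@mean_value_le _ (derive1n 2 f)) => x /(inM _ _ _ yM wM) xM;
    last exact: fC.
  by rewrite /= derive1E; apply: derivableP.
pose g w := f w - derive1 f y * w.
rewrite (_ : _ - _ = g z - g y); last by rewrite /g; ring.
rewrite -real_normK ?num_real// expr2 mulrA.
apply: (@mean_value_le g (fun w => derive1 f w - derive1 f y)) => // w _.
apply: is_deriveB.
  by rewrite derive1E; exact: derivableP.
by rewrite -[X in is_derive _ _ _ X]mulr1; apply: is_deriveZ.
Qed.

End mean_value.

(** * Expansion of the reduced cost *)

Section expansion.
Context {disp} {X : measurableType disp} {R : realType}.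
Variables (m : {measure set X -> \bar R}) (D : set X).
Hypothesis cm : measure_is_complete m.
Hypothesis mD : measurable D.
Hypothesis mDoo : (m D < +oo)%E.
Local Notation L2 := (Lp m D 2%:E).
Local Notation N f := (fine (Lpnorm m D 2%:E f)).
Local Notation intg f := (m.-integrable D (EFin \o f)).
Local Notation I f := (\int[m]_(x in D) (f x)).

Lemma integrable_measurable (f : X -> R) : intg f -> measurable_fun D f.
Proof. by move=> /measurable_int /measurable_EFinP. Qed.

Lemma integrable_lin (f g : X -> R) (a b : R) : intg f -> intg g ->
  intg (fun x => a * f x + b * g x).
Proof.
by move=> If Ig; exact: (integrableD mD (integrableZl mD a If) (integrableZl mD
  b Ig)).
Qed.

Lemma Rintegral_lin (f g : X -> R) (a b : R) : intg f -> intg g ->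
  \int[m]_(x in D) (a * f x + b * g x) = a * I f + b * I g.
Proof.
move=> If Ig; rewrite RintegralD ?RintegralZl//; first exact: integrableZl If.
exact: integrableZl Ig.
Qed.

Lemma mul_bounded_integrable (f phi : X -> R) (b : R) : intg f ->
  measurable_fun D phi -> (forall x, D x -> `|phi x| <= b) ->
  intg (fun x => f x * phi x).
Proof.
move=> If mphi phib; have mf := integrable_measurable If.
apply: (ae_le_integrable mD (g := fun x => `|b| * `|f x|)).
- exact: measurable_funM.
- apply: nearW => x Dx; rewrite normrM mulrC ler_wpM2r//.
  by rewrite (le_trans (phib x Dx))// ler_norm.
- have Ia : intg (fun x => `|f x|).
    apply: le_integrable If => //; last by move=> x _ /=; rewrite normr_id.
    by apply/measurable_EFinP; exact: measurableT_comp.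
  exact: (integrableZl mD `|b| Ia).
Qed.

Section superposition.
Variables (f : X -> R -> R) (K : X -> R) (C M b : R) (phi : X -> R).
Hypothesis mf : forall s, measurable_fun D (f ^~ s).
Hypothesis df : {ae m, forall x, D x ->
  (forall s, derivable (f x) s 1) /\ forall s, derivable (derive1 (f x)) s 1}.
Hypothesis f0 : intg (f ^~ 0).
Hypothesis IK : intg K.
Hypothesis fK : {ae m, forall x, D x -> forall s, `|s| <= M ->
  `|derive1 (f x) s| <= K x}.
Hypothesis fC : {ae m, forall x, D x -> forall s, `|s| <= M ->
  `|derive1n 2 (f x) s| <= C}.
Hypothesis mphi : measurable_fun D phi.
Hypothesis phib : forall x, D x -> `|phi x| <= b.

Let df1 : {ae m, forall x, D x -> forall s, derivable (f x) s 1}.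
Proof. by apply: filterS df => x + Dx => /(_ Dx)[]. Qed.

Lemma superposition_integrable (y : X -> R) : measurable_fun D y ->
  (forall x, D x -> `|y x| <= M) -> intg (fun x => f x (y x)).
Proof.
move=> my yM; have mg : measurable_fun D (fun x => f x (y x)).
  apply: (measurable_fun_comp_caratheodory cm) => //.
  apply: filterS df1 => x + Dx s => /(_ Dx s).
  by move/derivable1_diffP/differentiable_continuous.
have i0 : intg (fun x => `|f x 0|).
  apply: le_integrable f0 => //; last by move=> x _ /=; rewrite normr_id.
  by apply/measurable_EFinP; exact: measurableT_comp.
apply: (ae_le_integrable mD (g := fun x => 1 * `|f x 0| + M * K x)) => //;
  last first.
  exact: integrable_lin.
apply: filterS2 df1 fK => x + + Dx => /(_ Dx) dx /(_ Dx) Kx.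
rewrite -[f x (y x)](subrK (f x 0)) addrC mul1r.
apply: le_trans (ler_normD _ _) _; rewrite lerD2l.
have M0 : 0 <= M by exact: le_trans (yM x Dx).
have yx := yM x Dx.
apply: (@le_trans _ _ (K x * `|y x - 0|)); last first.
  rewrite mulrC subr0 ler_wpM2r//.
  by apply: le_trans (Kx 0 _); rewrite ?normr0.
apply: (@mean_value_le _ _ (derive1 (f x))) => w hw.
  by rewrite derive1E; exact: derivableP.
apply: Kx; move: hw yx; rewrite !ler_norml => /andP[w1 w2] /andP[y1 y2].
apply/andP; split.
  by apply: le_trans w1; rewrite le_min y1 andbT oppr_le0.
by apply: le_trans w2 _; rewrite ge_max y2 andbT.
Qed.

Lemma superposition_derive_integrable (y z : X -> R) : measurable_fun D y ->
  (forall x, D x -> `|y x| <= M) -> measurable_fun D z ->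
  (forall x, D x -> `|z x| <= M) -> intg (fun x =>
    derive1 (f x) (y x) * phi x * z x).
Proof.
move=> my yM mz zM.
apply: mul_bounded_integrable zM => //; apply: mul_bounded_integrable phib => //.
apply: (ae_le_integrable mD (g := K)) => //.
  exact: (measurable_fun_derive1_comp cm).
by apply: filterS fK => x + Dx => /(_ Dx); apply; exact: yM.
Qed.

(** This serves twice: for [a] weighted by the adjoint state and for [L] with weight 1. The
    first-order term is kept as two integrals, the shape in which the tested adjoint equation
    produces it. *)
Lemma superposition_remainder (y z : X -> R) (s : R) : measurable_fun D y ->
  (forall x, D x -> `|y x| <= M) -> measurable_fun D z ->
  (forall x, D x -> `|z x| <= M) -> {ae m, forall x, D x -> `|z x - y x| <= s} ->
  `|I (fun x => f x (z x) * phi x) - I (fun x => f x (y x) * phi x)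
    - (I (fun x => derive1 (f x) (y x) * phi x * z x) -
       I (fun x => derive1 (f x) (y x) * phi x * y x))|
  <= C * s ^+ 2 * b * fine (m D).
Proof.
move=> my yM mz zM zys.
have i1 := mul_bounded_integrable (superposition_integrable mz zM) mphi phib.
have i2 := mul_bounded_integrable (superposition_integrable my yM) mphi phib.
have i3 := superposition_derive_integrable my yM mz zM.
have i4 := superposition_derive_integrable my yM my yM.
have i12 := integrable_lin 1 (-1) i1 i2; have i34 := integrable_lin 1 (-1) i3 i4.
have i := integrable_lin 1 (-1) i12 i34.
rewrite -[X in `|X - _|]mulr1 -[X in `|_ - X|]mulr1.
rewrite (_ : `|_| = `|I (fun x =>
  1 * (1 * (f x (z x) * phi x) + -1 * (f x (y x) * phi x)) +
  -1 * (1 * (derive1 (f x) (y x) * phi x * z x) + -1 * (derive1 (f x) (y x) *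
    phi x * y x)))|); last first.
  by rewrite !Rintegral_lin//; congr `|_|; ring.
rewrite -(Rintegral_cst _ mD).
apply: ae_le_norm_Rintegral => //; first exact: integrable_measurable i;
  last exact: integrable_cstr.
apply: filterS3 df fC zys => x + + + Dx => /(_ Dx)[d1 d2] /(_ Dx) c /(_ Dx) zyx.
rewrite (_ : 1 * _ + _ = (f x (z x) - f x (y x) - derive1 (f x) (y x) * (z x - y
  x)) * phi x); last by ring.
have C0 : 0 <= C by exact: le_trans (c (y x) (yM x Dx)).
rewrite normrM; apply: ler_pM => //; last exact: phib.
apply: le_trans (taylor1_le d1 d2 c (yM x Dx) (zM x Dx)) _.
rewrite ler_wpM2l// -real_normK ?num_real// lerXn2r ?nnegrE//; exact: le_trans zyx.
Qed.

End superposition.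

(** [X1] and [X0] stand for the elliptic bilinear form of the adjoint state [phi] with the perturbed
    state [z] and with the state [y]; [bd] is the boundary term. Each is evaluated twice, by the
    state equation tested with [phi] and by the adjoint equation tested with the state. Equating the
    two values removes the gradients, and subtracting the identities for [z] and [y] removes
    [bd]. *)
Lemma reduced_cost_expansion (a L : X -> R -> R) (KL : X -> R) (Ka Ca CL M b : R)
  (u v y z phi : X -> R) (t s nu X0 X1 bd : R) :
  (forall s, measurable_fun D (a ^~ s)) -> (forall s, measurable_fun D (L ^~ s)) ->
  {ae m, forall x, D x ->
    (forall s, derivable (a x) s 1) /\ forall s, derivable (derive1 (a x)) s 1} ->
  {ae m, forall x, D x ->
    (forall s, derivable (L x) s 1) /\ forall s, derivable (derive1 (L x)) s 1} ->
  intg (a ^~ 0) -> intg (L ^~ 0) -> intg KL ->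
  {ae m, forall x, D x -> forall s, `|s| <= M -> `|derive1 (a x) s| <= Ka} ->
  {ae m, forall x, D x -> forall s, `|s| <= M -> `|derive1 (L x) s| <= KL x} ->
  {ae m, forall x, D x -> forall s, `|s| <= M -> `|derive1n 2 (a x) s| <= Ca} ->
  {ae m, forall x, D x -> forall s, `|s| <= M -> `|derive1n 2 (L x) s| <= CL} ->
  measurable_fun D phi -> (forall x, D x -> `|phi x| <= b) ->
  measurable_fun D y -> (forall x, D x -> `|y x| <= M) ->
  measurable_fun D z -> (forall x, D x -> `|z x| <= M) ->
  {ae m, forall x, D x -> `|z x - y x| <= s} -> 0 <= s -> 0 <= b ->
  L2 u -> L2 v ->
  X1 = \int[m]_(x in D) (- (a x (z x) + (u x + t * v x) * z x) * phi x) + bd ->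
  X0 = \int[m]_(x in D) (- (a x (y x) + u x * y x) * phi x) + bd ->
  X1 = \int[m]_(x in D) ((derive1 (L x) (y x) - (derive1 (a x) (y x) * phi x + u
    x * phi x)) * z x) ->
  X0 = \int[m]_(x in D) ((derive1 (L x) (y x) - (derive1 (a x) (y x) * phi x + u
    x * phi x)) * y x) ->
  `| (I (fun x => L x (z x)) + nu / 2 * \int[m]_(x in D) ((u x + t * v x) ^+ 2))
   - (I (fun x => L x (y x)) + nu / 2 * \int[m]_(x in D) (u x ^+ 2))
   - t * (nu * I (fun x => u x * v x) - I (fun x => v x * phi x * y x))
   - nu / 2 * t ^+ 2 * N v ^+ 2 |
  <= (CL + Ca * b) * fine (m D) * s ^+ 2 + b * N (fun=> 1) * (`|t| * s * N v).
Proof.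
move=> ma mL da dL a0 L0 IKL aK LK aC LC mphi phib my yM mz zM zys s0 b0 Lu Lv.
have IKa := integrable_cstr mD mDoo Ka.
have m1 : measurable_fun D (fun=> 1 : R) by [].
have b1 x : D x -> `|1 : R| <= 1 by rewrite normr1.
have := superposition_remainder ma da a0 IKa aK aC mphi phib my yM mz zM zys.
have := superposition_remainder mL dL L0 IKL LK LC m1 b1 my yM mz zM zys.
under [I (fun x => L x (z x) * 1)]eq_Rintegral do rewrite mulr1.
under [I (fun x => L x (y x) * 1)]eq_Rintegral do rewrite mulr1.
under [I (fun x => derive1 (L x) (y x) * 1 * z x)]eq_Rintegral do rewrite mulr1.
under [I (fun x => derive1 (L x) (y x) * 1 * y x)]eq_Rintegral do rewrite mulr1.
have iaz := mul_bounded_integrable (superposition_integrable ma da a0 IKa aK mz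
  zM) mphi phib.
have iay := mul_bounded_integrable (superposition_integrable ma da a0 IKa aK my
  yM) mphi phib.
have idaz := superposition_derive_integrable ma da IKa aK mphi phib my yM mz zM.
have iday := superposition_derive_integrable ma da IKa aK mphi phib my yM my yM.
have idLz : intg (fun x => derive1 (L x) (y x) * z x).
  apply: eq_integrable (superposition_derive_integrable mL dL IKL LK m1 b1 my yM
    mz zM) => //.
  by move=> x _ /=; rewrite mulr1.
have idLy : intg (fun x => derive1 (L x) (y x) * y x).
  apply: eq_integrable (superposition_derive_integrable mL dL IKL LK m1 b1 my yM
    my yM) => //.
  by move=> x _ /=; rewrite mulr1.
have Iu := L2_integrable mD mDoo Lu; have Iv := L2_integrable mD mDoo Lv.
have iuz := mul_bounded_integrable (mul_bounded_integrable Iu mphi phib) mz zM.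
have iuy := mul_bounded_integrable (mul_bounded_integrable Iu mphi phib) my yM.
have ivz := mul_bounded_integrable (mul_bounded_integrable Iv mphi phib) mz zM.
have ivy := mul_bounded_integrable (mul_bounded_integrable Iv mphi phib) my yM.
(* The source of the cross term: the state increment is bounded by [s], and the L^1 norm of [v] by
   its L^2 norm. *)
have CSv : `|I (fun x => v x * phi x * z x) - I (fun x =>
  v x * phi x * y x)| <= b * s * N v * N (fun=> 1).
  have i := integrable_lin 1 (-1) ivz ivy.
  have iav : intg (fun x => `|v x|) by exact: L2_integrable (L2_abs mD Lv).
  rewrite (_ : `|_| = `|I (fun x =>
    1 * (v x * phi x * z x) + -1 * (v x * phi x * y x))|); last first.
    by rewrite Rintegral_lin//; congr `|_|; ring.
  apply: (@le_trans _ _ (I (fun x => b * s * `|v x|))).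
    apply: ae_le_norm_Rintegral => //; first exact: integrable_measurable i;
      last first.
      exact: (integrableZl mD (b * s) iav).
    apply: filterS zys => x + Dx => /(_ Dx) zyx;
      rewrite (_ : _ + _ = phi x * (z x - y x) * v x); last by ring.
    by rewrite !normrM ler_wpM2r// ler_pM// phib.
  by have := ler_wpM2l (mulr_ge0 b0 s0) (L1_le_L2 mD mDoo Lv);
    rewrite RintegralZl// !mulrA.
have Esq : \int[m]_(x in D) ((u x + t * v x) ^+ 2) =
    t ^+ 2 * N v ^+ 2 + t * 2 * I (fun x =>
      u x * v x) + \int[m]_(x in D) (u x ^+ 2).
  have := L2norm_sqrD mD t Lv Lu;
    rewrite (L2norm_sqr mD (L2_linear mD t Lv Lu)) (L2norm_sqr mD Lu).
  under [I (fun x => v x * u x)]eq_Rintegral do rewrite mulrC.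
  by move=> <-; apply: eq_Rintegral => x _; rewrite addrC.
have E1 : \int[m]_(x in D) (- (a x (z x) + (u x + t * v x) * z x) * phi x) =
  - I (fun x => a x (z x) * phi x) - I (fun x =>
      u x * phi x * z x) - t * I (fun x => v x * phi x * z x).
  rewrite (_ : \int[m]_(x in D) _ = I (fun x =>
    -1 * (1 * (a x (z x) * phi x) + 1 * (u x * phi x * z x))
    + (- t) * (v x * phi x * z x))); last by apply: eq_Rintegral => x _; ring.
  have i := integrable_lin 1 1 iaz iuz.
  by rewrite !Rintegral_lin//; ring.
have E2 : \int[m]_(x in D) (- (a x (y x) + u x * y x) * phi x) =
  - I (fun x => a x (y x) * phi x) - I (fun x => u x * phi x * y x).
  rewrite (_ : \int[m]_(x in D) _ = I (fun x =>
    -1 * (a x (y x) * phi x) + -1 * (u x * phi x * y x))).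
    by rewrite Rintegral_lin//; ring.
  by apply: eq_Rintegral => x _; ring.
have E3 w : intg (fun x => derive1 (L x) (y x) * w x) ->
  intg (fun x => derive1 (a x) (y x) * phi x * w x) -> intg (fun x =>
    u x * phi x * w x) ->
  \int[m]_(x in D) ((derive1 (L x) (y x) - (derive1 (a x) (y x) * phi x + u x *
    phi x)) * w x) =
  I (fun x => derive1 (L x) (y x) * w x) - I (fun x =>
    derive1 (a x) (y x) * phi x * w x)
   - I (fun x => u x * phi x * w x).
  move=> i1 i2 i3; have i := integrable_lin 1 (-1) i1 i2.
  rewrite (_ : \int[m]_(x in D) _ = I (fun x =>
    1 * (1 * (derive1 (L x) (y x) * w x) +
    -1 * (derive1 (a x) (y x) * phi x * w x)) + -1 * (u x * phi x * w x))).
    by rewrite !Rintegral_lin//; ring.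
  by apply: eq_Rintegral => x _; ring.
rewrite E1 E2 !E3// Esq.
move: CSv.
set iaz' := I (fun x => a x (z x) * phi x); set iay' := I (fun x =>
  a x (y x) * phi x).
set iLz := I (fun x => L x (z x)); set iLy := I (fun x => L x (y x)).
set dLz := I (fun x => derive1 (L x) (y x) * z x); set dLy := I (fun x =>
  derive1 (L x) (y x) * y x).
set daz := I (fun x => derive1 (a x) (y x) * phi x * z x).
set day := I (fun x => derive1 (a x) (y x) * phi x * y x).
set vz := I (fun x => v x * phi x * z x); set vy := I (fun x => v x * phi x * y x).
set uz := I (fun x => u x * phi x * z x); set uy := I (fun x => u x * phi x * y x).
set uv := I (fun x => u x * v x); set uu := \int[m]_(x in D) _.
move=> CSv rL ra hX1 hX0 hX1' hX0'.
(* What remains is the Taylor remainder of [L], that of [a] weighted by [phi], and the coupling of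
   [v] with the state increment. [h1] and [h0] equate the two evaluations of [X1] and [X0]. *)
rewrite (_ : _ - _ - _ - _ = (iLz - iLy - (dLz - dLy)) - (iaz' - iay' - (daz -
  day)) - t * (vz - vy)); last first.
  have h1 := etrans (esym hX1) hX1'; have h0 := etrans (esym hX0) hX0'.
  have -> : iaz' = - uz - t * vz + bd - dLz + daz + uz by lra.
  have -> : iay' = - uy + bd - dLy + day + uy by lra.
  by field.
have tv := ler_wpM2l (normr_ge0 t) CSv; rewrite -normrM in tv.
apply: le_trans (ler_normB _ _) _;
  apply: (@le_trans _ _ (CL * s ^+ 2 * 1 * fine (m D) +
  Ca * s ^+ 2 * b * fine (m D) + `|t| * (b * s * N v * N (fun=> 1)))).
  by apply: lerD => //; apply: le_trans (ler_normB _ _) _; exact: lerD.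
by rewrite le_eqVlt; apply/orP; left; apply/eqP; ring.
Qed.

End expansion.

(** * Compactness of Holder balls *)

(** Arzela-Ascoli for sequences. Along an ultrafilter finer than [\oo] the values are Cauchy at
    every point of [K] at once, which avoids a diagonal extraction over points. Equicontinuity and
    the near-covering form of compactness make this uniform. *)
Lemma uniform_cauchy_subsequence {R : realType} {T : topologicalType} (K : set T)
  (z : nat -> T -> R) (C : R) : compact K ->
  (forall k x, K x -> `|z k x| <= C) ->
  (forall x (e : R), K x -> 0 < e ->
    \forall x' \near x, K x' -> forall k, `|z k x' - z k x| <= e) ->
  exists f : nat -> nat, (forall k, (k <= f k)%N) /\
    forall e : R, 0 < e -> exists n, forall k l, (n <= k)%N -> (n <= l)%N ->
      forall x, K x -> `|z (f k) x - z (f l) x| <= e.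
Proof.
move=> cK zC zeq.
have [U [UU nU]] := @ultraFilterLemma nat \oo _.
have PU : ProperFilter U by exact: ultra_proper.
have pt x (e : R) : K x -> 0 < e ->
    exists2 A, U A & forall k l, A k -> A l -> `|z k x - z l x| <= e.
  move=> Kx e0.
  have cC : compact (`[- C, C]%classic : set R) by exact: segment_compact.
  have [|w [_ wcl]] := cC ((z ^~ x) @ U) _.
    have h : U [set k | - C <= z k x <= C].
      by apply: filterS filterT => k _ /=; have := zC k x Kx; rewrite ler_norml.
    by apply: (@filterS _ U _ _ _ _ h) => k /=; rewrite in_itv.
  pose A := [set k | `|w - z k x| < e / 2].
  (* If the ultrafilter contained the complement of [A], then [w] could not be a cluster point. *)
  have [UA|UnA] := in_ultra_setVsetC A UU.
    exists A => // k l Ak Al.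
    rewrite (_ : _ - _ = (w - z l x) - (w - z k x)); last by ring.
    by rewrite (le_trans (ler_normB _ _))// [leRHS]splitr lerD// ltW.
  have B : nbhs w (ball w (e / 2)) by apply: nbhsx_ballx; rewrite divr_gt0.
  have [|y [nAy wy]] := wcl (~` ball w (e / 2)) _ _ B; last by [].
  exact: UnA.
have unif (e : R) : 0 < e ->
    exists2 A, U A & forall k l, A k -> A l -> forall x, K x ->
      `|z k x - z l x| <= e.
  move=> e0; have /near_covering_withinP ncK := (compact_near_coveringP K).1 cK.
  have e3 : 0 < e / 3 by rewrite divr_gt0.
  (* Compactness is applied to pairs of indices. Near each point, equicontinuity enters twice and
     [pt] once, hence [e / 3]. *)
  have := ncK _ (filter_prod U U) (fun kl x => `|z kl.1 x - z kl.2 x| <= e) _ _.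
  case => [x Kx|[A B] /= [UA UB] AB].
    have [A UA Ae] := pt x _ Kx e3.
    exists ([set x' | K x' -> forall k, `|z k x' - z k x| <= e / 3], A `*` A) => /=.
      split; first exact: zeq.
      by exists (A, A).
    move=> [x' [k l]] /= [h [Ak Al]] Kx'.
    rewrite (_ : _ - _ = (z k x' - z k x) + (z k x - z l x) - (z l x' - z l x));
      last by ring.
    rewrite (le_trans (ler_normB _ _))// (le_trans (lerD (ler_normD _ _) (lexx
      _)))//.
    by have := h Kx' k; have := h Kx' l; have := Ae k l Ak Al; lra.
  exists (A `&` B); first exact: filterI.
  by move=> k l [Ak _] [_ Bl] x Kx; exact: (AB (k, l)).
have /choice[A hA] (n : nat) : exists A, U A /\
    forall k l, A k -> A l -> forall x, K x -> `|z k x - z l x| <= n.+1%:R^-1.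
  by have [|A UA h] := unif n.+1%:R^-1; [rewrite invr_gt0|exists A].
(* The index [f k] is chosen in all of [A 0], ..., [A k], so any two terms of rank at least [n] have
   indices in [A n]. *)
have /choice[f hf] (k : nat) : exists j, (k <= j)%N /\ forall i, (i <= k)%N ->
  A i j.
  suff : U [set j | (k <= j)%N /\ forall i, (i <= k)%N -> A i j].
    by move=> /(@filter_ex _ U)[j jP]; exists j.
  apply: filterI; first by apply: nU; exists k.
  elim: k => [|k IH].
    by apply: filterS (hA 0%N).1 => j Aj i; rewrite leqn0 => /eqP ->.
  apply: filterS2 IH (hA k.+1).1 => j h Aj i.
  by rewrite leq_eqVlt ltnS => /orP[/eqP ->|/h].
exists f; split; first by move=> k; have [] := hf k.
move=> e e0; exists (Num.truncn e^-1) => k l nk nl x Kx.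
have := (hA (Num.truncn e^-1)).2 (f k) (f l) ((hf k).2 _ nk) ((hf l).2 _ nl) x Kx.
move/le_trans; apply; rewrite invf_ple ?posrE//.
by rewrite ltW// truncnS_gt.
Qed.

Section enorm.
Context {R : realType} {d : nat}.

(** Neighbourhoods of row vectors come from the sup norm, whereas Holder quotients use [enorm]. *)
Lemma enorm_le (x : 'rV[R]_d) : enorm x <= Num.sqrt d%:R * `|x|.
Proof.
have -> : Num.sqrt d%:R * `|x| = Num.sqrt (d%:R * `|x| ^+ 2) :> R.
  by rewrite sqrtrM// sqrtr_sqr normr_id.
rewrite /enorm ler_sqrt; last by rewrite mulr_ge0// sqr_ge0.
rewrite /dotv -[d in d%:R](card_ord d) -sumr_const mulr_suml; apply: ler_sum => i _.
rewrite mul1r -expr2 -real_normK ?num_real// lerXn2r ?nnegrE//.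
by rewrite [leRHS]mx_normrE; apply: (le_bigmax _ (fun ij => `|x ij.1 ij.2|) (0, i)).
Qed.

Lemma holder_equicontinuous (z : nat -> 'rV[R]_d ->
  R) (K : set 'rV[R]_d) (C mu : R) :
  0 < mu -> (forall k x y, K x -> K y ->
    `|z k x - z k y| <= C * enorm (x - y) `^ mu) ->
  forall x (e : R), K x -> 0 < e ->
    \forall x' \near x, K x' -> forall k, `|z k x' - z k x| <= e.
Proof.
move=> mu0 zC x e Kx e0.
have C1 : 0 < `|C| + 1 by rewrite ltr_wpDl.
(* The radius at which the Holder bound with constant [|C| + 1] equals [e]; this constant is
   positive whatever the sign of [C]. *)
pose r := (e / (`|C| + 1)) `^ mu^-1.
have r0 : 0 < r by rewrite powR_gt0// divr_gt0.
have d1 : 0 < Num.sqrt d%:R + 1 :> R by rewrite ltr_wpDl// sqrtr_ge0.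
have : \forall x' \near x, `|x - x'| < r / (Num.sqrt d%:R + 1).
  by apply/nbhs_ballP; exists (r / (Num.sqrt d%:R + 1)) => //=;
    [exact: divr_gt0|rewrite mx_norm_ball].
apply: filterS => x' x'x Kx' k; apply: le_trans (zC k _ _ Kx' Kx) _.
have xr : enorm (x' - x) <= r.
  apply: le_trans (enorm_le _) _; rewrite distrC.
  apply: (@le_trans _ _ ((Num.sqrt d%:R + 1) * (r / (Num.sqrt d%:R + 1)))).
    by apply: ler_pM => //; [rewrite lerDl|exact: ltW].
  by rewrite mulrC divfK// gt_eqF.
apply: (@le_trans _ _ ((`|C| + 1) * r `^ mu)).
  apply: le_trans (ler_norm _) _; rewrite normrM; apply: ler_pM => //;
    first by rewrite lerDl.
  rewrite ger0_norm ?powR_ge0// ge0_ler_powR ?(ltW mu0)// ?nnegrE ?sqrtr_ge0//;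
    exact: ltW.
by rewrite -powRrM mulVf ?gt_eqF// powRr1 ?(ltW (divr_gt0 e0 C1))// mulrC
  divfK// gt_eqF.
Qed.

End enorm.

(** * Derivatives and second differences on the real line *)

Section second_difference.
Context {R : realType}.

Lemma is_derive_of_little_o (f : R -> R) (x df : R) :
  (forall e, 0 < e -> exists2 delta, 0 < delta &
    forall s, `|s| < delta -> `|f (x + s) - f x - df * s| <= e * `|s|) ->
  is_derive x 1 f df.
Proof.
move=> fo.
have cf : h^-1 *: (f (h *: (1 : R) + x) - f x) @[h --> 0^'] --> df.
  apply/cvgrPdist_le => e e0; have [r r0 hr] := fo e e0.
  near=> h.
  have h0 : h != 0 by near: h; exact: nbhs_dnbhs_neq.
  have hr' : `|h| < r.
    near: h; apply: dnbhs0_lt => //.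
  rewrite (_ : df - _ = - (h^-1 * (f (x + h) - f x - df * h))); last first.
    by rewrite [h *: 1]mulr1 [h + x]addrC /GRing.scale/=; field.
  by rewrite normrN normrM normfV ler_pdivrMl ?normr_gt0// [leRHS]mulrC; exact: hr.
apply: DeriveDef; first by apply/cvg_ex; exists df.
by apply: cvg_lim => //; exact: cf.
Unshelve. all: by end_near. Qed.

(** The function [j w + j (- w) - w ^+ 2 * q] has derivative [dj w - dj (- w) - 2 * w * q], in which
    [dj 0] cancels. The mean value inequality on [[0, t]] concludes, from a first-order expansion of
    [dj] at 0 alone. *)
Lemma second_difference_le (j dj : R -> R) (q c t : R) : 0 <= t ->
  (forall w : R, `|w| <= t -> is_derive w 1 j (dj w)) ->
  (forall w : R, `|w| <= t -> `|dj w - dj 0 - w * q| <= c * `|w|) ->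
  `|j t + j (- t) - 2 * j 0 - t ^+ 2 * q| <= 2 * c * t ^+ 2.
Proof.
move=> t0 djP djq.
have [->|tn0] := eqVneq t 0.
  by rewrite oppr0 expr0n mul0r mulr0 subr0 (_ : _ - _ = 0) ?normr0//; ring.
have c0 : 0 <= c.
  have := djq t; rewrite ger0_norm// => /(_ (lexx _)) /(le_trans (normr_ge0 _)).
  by rewrite pmulr_lge0// lt_neqAle eq_sym tn0.
pose F w := j w + j (- w) - w ^+ 2 * q.
have -> : j t + j (- t) - 2 * j 0 - t ^+ 2 * q = F t - F 0.
  by rewrite /F oppr0; ring.
have -> : 2 * c * t ^+ 2 = 2 * c * t * `|t - 0| by rewrite subr0 ger0_norm//; ring.
have int w : Num.min 0 t <= w <= Num.max 0 t -> 0 <= w <= t.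
  by rewrite (min_idPl t0) (max_idPr t0).
apply: (@mean_value_le _ _ (fun w => dj w - dj (- w) - 2 * w * q)) =>
  w /int /andP[w0 wt].
  have d1 : is_derive w 1 j (dj w) by apply: djP; rewrite ger0_norm.
  have d2 : is_derive (- w) 1 j (dj (- w)) by apply: djP; rewrite normrN ger0_norm.
  have d3 : is_derive w 1 (fun w => j (- w)) (- dj (- w)).
    have dN : is_derive w 1 (fun w : R => - w) (- 1) by apply: is_deriveN.
    have := @is_derive1_comp _ j (fun w : R => - w) w _ _ d2 dN.
    by rewrite mulrN1.
  have d4 : is_derive w 1 (fun w : R => w ^+ 2 * q) (2 * w * q).
    have : is_derive w 1 (q *: (@id R) ^+ 2) (2 * w * q).
      by apply: is_derive_eq; rewrite /GRing.scale/=; ring.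
    by rewrite (_ : q *: _ = (fun w : R => w ^+ 2 * q))//; apply/funext => z;
      rewrite mulrC.
  exact: (is_deriveB (is_deriveD d1 d3) d4).
have n1 : `|w| <= t by rewrite ger0_norm.
have n2 : `|- w| <= t by rewrite normrN.
have := djq _ n1; have := djq _ n2; rewrite normrN (ger0_norm w0) => h1 h2.
rewrite (_ : _ - _ = (dj w - dj 0 - w * q) - (dj (- w) - dj 0 - - w * q));
  last by ring.
apply: le_trans (ler_normB _ _) _; apply: le_trans (lerD h2 h1) _.
by have := ler_wpM2l c0 wt; lra.
Qed.

End second_difference.

(** * Pointwise bounds from Holder norms *)

Section holder.
Context {R : realType} {d : nat}.
Implicit Types (K : set 'rV[R]_d) (f : 'rV[R]_d -> R).

(** Two distinct points make both suprema in [holder_norm] nonnegative, so a bound on the sum bounds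
    each. A supremum over the empty set would be [-oo] and spoil this. *)
Lemma holder_norm_le mu K f (c : R) : 0 < mu ->
  (exists x y, [/\ K x, K y & x != y]) -> (holder_norm mu K f <= c%:E)%E ->
  (forall x, K x -> `|f x| <= c) /\
  (forall x y, K x -> K y -> `|f x - f y| <= c * enorm (x - y) `^ mu).
Proof.
move=> mu0 [x0 [y0 [Kx0 Ky0 xy0]]]; rewrite /holder_norm.
set s1 := ereal_sup _; set s2 := ereal_sup _ => sc.
have s1_ge x : K x -> (`|f x|%:E <= s1)%E.
  by move=> Kx; apply: ereal_sup_ubound; exists x.
have s2_ge x y : K x -> K y -> x != y ->
  ((`|f x - f y| / enorm (x - y) `^ mu)%:E <= s2)%E.
  by move=> Kx Ky xy; apply: ereal_sup_ubound; exists (x, y).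
have s10 : (0 <= s1)%E by apply: le_trans (s1_ge _ Kx0); rewrite lee_fin.
have s20 : (0 <= s2)%E.
  by apply: le_trans (s2_ge _ _ Kx0 Ky0 xy0); rewrite lee_fin divr_ge0// powR_ge0.
have c0 : 0 <= c by rewrite -lee_fin (le_trans _ sc)// adde_ge0.
split=> [x Kx|x y Kx Ky].
  by rewrite -lee_fin; apply: le_trans (s1_ge _ Kx) _; apply: le_trans sc;
    rewrite leeDl.
have [->|xy] := eqVneq x y; first by rewrite !subrr normr0 mulr_ge0// powR_ge0.
have : enorm (x - y) != 0.
  apply: contra_neq xy => /eqP; rewrite /enorm sqrtr_eq0 => h.
  apply/rowP => i; apply/eqP; rewrite -subr_eq0 -sqrf_eq0.
  rewrite eq_le sqr_ge0 andbT (le_trans _ h)// /dotv (bigD1 i)//= !mxE -expr2 lerDl.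
  by apply: sumr_ge0 => k _; rewrite -expr2 sqr_ge0.
rewrite /enorm => e0.
have ep : 0 < Num.sqrt (dotv (x - y) (x - y)) `^ mu by rewrite powR_gt0// lt0r
  e0 sqrtr_ge0.
rewrite -ler_pdivrMr// -lee_fin.
by apply: le_trans (s2_ge _ _ Kx Ky xy) _; apply: le_trans sc; rewrite leeDr.
Qed.

Lemma H1norm_ge0 (Omega : set 'rV[R]_d) y : (0 <= H1norm Omega y)%E.
Proof. exact: poweR_ge0. Qed.

Lemma H1Cnorm_le (Omega : set 'rV[R]_d) mu (y : weak_fun) (c : R) : 0 < mu ->
  (exists x y, [/\ closure Omega x, closure Omega y & x != y]) ->
  (H1Cnorm Omega mu y <= c%:E)%E ->
  (forall x, closure Omega x -> `|y.1 x| <= c) /\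
  (forall x x', closure Omega x -> closure Omega x' ->
     `|y.1 x - y.1 x'| <= c * enorm (x - x') `^ mu).
Proof.
move=> mu0 pts yc; apply: (holder_norm_le mu0 pts).
by apply: le_trans yc; rewrite /H1Cnorm leeDr// H1norm_ge0.
Qed.

Lemma open_two_points (Omega : set 'rV[R]_d) : (0 < d)%N -> Omega !=set0 ->
  open Omega ->
  exists x y, [/\ Omega x, Omega y & x != y].
Proof.
move=> d0 [x Ox] oO.
have /nbhs_ballP[e /= e0 xeO] : nbhs x Omega by exact: open_nbhs_nbhs.
exists x, (x + const_mx (e / 2)); split=> //.
  apply: xeO; split=> // i k; rewrite !mxE /ball/= opprD addNKr normrN.
  by rewrite ger0_norm ?divr_ge0 ?(ltW e0)// ltr_pdivrMr// ltr_pMr// ltr1n.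
rewrite eq_sym -subr_eq0 addrAC subrr add0r; apply/eqP => /rowP/(_ (Ordinal d0)).
by rewrite !mxE => /eqP; rewrite gt_eqF// divr_gt0.
Qed.

End holder.

(** * The control problem *)

Section almost_everywhere_lebesgue.
Context {R : realType} {d : nat}.
Local Notation leb := (@lebesgue R d).

Lemma lebesgue_ae_imp (P Q : 'rV[R]_d -> Prop) :
  (forall x, P x -> Q x) ->
  {ae leb, forall x, P x} -> {ae leb, forall x, Q x}.
Proof.
move=> PQ; apply: (@filterS _ (nbhs (almost_everywhere leb))).
exact: PQ.
Qed.

Lemma lebesgue_ae_imp2 (P Q S : 'rV[R]_d -> Prop) :
  (forall x, P x -> Q x -> S x) ->
  {ae leb, forall x, P x} -> {ae leb, forall x, Q x} -> {ae leb, forall x, S x}.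
Proof.
move=> PQS; apply: (@filterS2 _ (nbhs (almost_everywhere leb))).
exact: PQS.
Qed.

Lemma lebesgue_ae_forall (P : nat -> 'rV[R]_d -> Prop) :
  (forall n, {ae leb, forall x, P n x}) -> {ae leb, forall x, forall n, P n x}.
Proof.
move=> aeP; have : leb.-negligible (\bigcup_n ~` [set x | P n x]).
  by apply: negligible_bigcup => n; exact: aeP.
apply: negligibleS => x /= /existsNP[n nP]; by exists n.
Qed.

(** A set of outer measure 0 is Caratheodory measurable, so this applies to [Sigma_] without a
    separate proof of measurability. *)
Lemma lebesgue_ae_null (S : set 'rV[R]_d) : leb S = 0%E -> {ae leb, forall x,
  ~ S x}.
Proof.
move=> S0; exists S; split=> //; last by move=> x /= /contrapT.
apply: le_caratheodory_measurable => X.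
have S0' : @lebesgue_outer_measure R d S = 0%E by [].
have -> : @lebesgue_outer_measure R d (X `&` S) = 0%E.
  apply/eqP; rewrite eq_le outer_measure_ge0 andbT -S0'.
  by apply: le_outer_measure; exact: subIsetr.
by rewrite add0e; apply: le_outer_measure; exact: subIsetl.
Qed.

End almost_everywhere_lebesgue.

Section domain.
Context {R : realType} {d : nat}.
Variable Omega : set 'rV[R]_d.
Hypothesis d0 : (0 < d)%N.
Hypothesis hOmega : lipschitz_domain Omega.
Local Notation leb := (@lebesgue R d).
Local Notation N v := (fine (L2norm Omega v)).

Lemma domain_measurable : measurable (Omega : set (caratheodory_type
  (@lebesgue_outer_measure R d))).
Proof. by have [_ oO _ _ _] := hOmega; exact: measurable_open. Qed.

Lemma domain_finite_measure : (leb Omega < +oo)%E.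
Proof. by have [_ _ _ bO _] := hOmega; exact: lebesgue_bounded. Qed.

Lemma lebesgue_complete : measure_is_complete leb.
Proof. exact: measure_is_complete_caratheodory. Qed.

Lemma domain_two_points : exists x y, [/\ closure Omega x,
  closure Omega y & x != y].
Proof.
have [ne0 oO _ _ _] := hOmega; have [x [y [Ox Oy xy]]] := open_two_points d0 ne0 oO.
by exists x, y; split=> //; exact: subset_closure.
Qed.

Lemma closure_domain_compact : compact (closure Omega).
Proof.
have [_ _ _ /pinfty_ex_gt0[M M0 OM] _] := hOmega.
apply: bounded_closed_compact; last exact: closed_closure.
exists M; split; first exact: num_real.
move=> r Mr x clx; have [y [Oy]] : Omega `&` ball x (r - M) !=set0.
  by apply: clx; apply: nbhsx_ballx; rewrite subr_gt0.
rewrite mx_norm_ball /ball_ /= => xy; rewrite -(subrK y x).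
apply: le_trans (ler_normD _ _) _; have := OM y Oy => /= yM.
by rewrite -(subrK M r) lerD// ltW.
Qed.

End domain.

Section control_problem.
Context {R : realType} {d : nat}.
Variables (Omega : set 'rV[R]_d) (A : 'rV[R]_d -> 'M[R]_d) (p : \bar R).
Variables (a : 'rV[R]_d -> R -> R) (a0 : R) (g : 'rV[R]_d -> R) (L : 'rV[R]_d ->
  R -> R).
Variables (nu mu : R) (eps : ('rV[R]_d -> R) -> R).
Variables (G : ('rV[R]_d -> R) -> @weak_fun R d).
Variable (DG : ('rV[R]_d -> R) -> ('rV[R]_d -> R) -> @weak_fun R d).
Variable (D2G : ('rV[R]_d -> R) -> ('rV[R]_d -> R) -> ('rV[R]_d -> R) ->
  @weak_fun R d).
Variable (DJ : ('rV[R]_d -> R) -> ('rV[R]_d -> R) -> R).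
Variable (D2J : ('rV[R]_d -> R) -> ('rV[R]_d -> R) -> ('rV[R]_d -> R) -> R).
Variables (ub : 'rV[R]_d -> R) (yb phib : @weak_fun R d).
Hypothesis d0 : (0 < d)%N.
Hypothesis hOmega : lipschitz_domain Omega.
Hypothesis p1 : (1 <= p)%E.
Hypothesis ha : nonlinearity Omega p a a0.
Hypothesis hL : cost_integrand Omega p L.
Hypothesis mu0 : 0 < mu.
Hypothesis eps0 : forall u, calA0 Omega a0 u -> 0 < eps u.
Hypothesis G_state : forall u, calA Omega a0 eps u ->
  H1C Omega mu (G u) /\ state_eq Omega A a g u (G u).
Hypothesis G_unique : forall u y, calA Omega a0 eps u -> H1C Omega mu y ->
  state_eq Omega A a g u y ->
  {ae @lebesgue R d, forall x, Omega x -> y.1 x = (G u).1 x}.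
Hypothesis hG : C2_on (L2 Omega) (L2norm Omega) (H1C Omega mu) (H1Cnorm Omega
  mu) (calA Omega a0 eps) G DG D2G.
Hypothesis hJ : C2_on (L2 Omega) (L2norm Omega) setT (fun r : R => `|r|%:E)
          (calA Omega a0 eps) (J Omega L nu G) DJ D2J.
Hypothesis hub : calA0 Omega a0 ub.
Hypothesis hyb : H1C Omega mu yb.
Hypothesis hphib : H1C Omega mu phib.
Hypothesis hstate : state_eq Omega A a g ub yb.
Hypothesis hadj : adjoint_eq Omega A a L ub yb phib.
Local Notation leb := (@lebesgue R d).
Local Notation N v := (fine (L2norm Omega v)).
Local Notation z v x := ((DG ub v).1 x).
Let mO := domain_measurable hOmega.
Let mOoo := domain_finite_measure hOmega.
Let cm : measure_is_complete leb := @lebesgue_complete R d.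

Lemma H1C_bounded y : H1C Omega mu y -> exists c, forall x, closure Omega x ->
  `|y.1 x| <= c.
Proof.
move=> [_ yoo]; have [c yc] : exists c : R,
  (holder_norm mu (closure Omega) y.1 <= c%:E)%E.
  by move: yoo; case: holder_norm => [r _| |_] //; [exists r|exists 0;
    rewrite leNye].
by exists c; have [] := holder_norm_le mu0 (domain_two_points d0 hOmega) yc.
Qed.

Lemma H1C_measurable y : H1C Omega mu y ->
  measurable_fun (Omega : set (caratheodory_type (@lebesgue_outer_measure R d)))
    y.1.
Proof. by move=> [[[]]]. Qed.

Lemma L2norm_EFin v : L2 Omega v -> L2norm Omega v = (N v)%:E.
Proof. by move=> /L2norm_fin_num ->. Qed.

Lemma calA_near v (t : R) : L2 Omega v -> `|t| * N v < eps ub ->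
  calA Omega a0 eps (ub + t *: v).
Proof.
move=> Lv tv; have Lu : L2 Omega ub by case: hub.
have Ltv : L2 Omega (t *: v) by exact: (L2_scale mO).
split; first exact: (L2_add mO).
exists ub => //; rewrite [ub + _]addrC addrK L2norm_EFin// lte_fin.
by rewrite /L2norm (L2norm_scale mO).
Qed.

Lemma calA_ub : calA Omega a0 eps ub.
Proof.
have Lu : L2 Omega ub by case: hub.
have := @calA_near (ub - ub) 0 (L2_sub mO Lu Lu).
by rewrite scale0r addr0 normr0 mul0r; apply; exact: eps0.
Qed.

(** The adjoint equation is written at [yb] and [J] at [G ub]; this reconciles them. *)
Lemma G_ub_ae : {ae leb, forall x, Omega x -> yb.1 x = (G ub).1 x}.
Proof. exact: G_unique calA_ub hyb hstate. Qed.

(** [C2_on] gives linearity up to a defect of seminorm 0. The sup part of [H1Cnorm] turns this into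
    equality at every point of the closure. *)
Lemma DG_linear c h k x : L2 Omega h -> L2 Omega k -> closure Omega x ->
  z (c *: h + k) x = c * z h x + z k x.
Proof.
move=> Lh Lk cx; have [[_ lin _] _ _ _ _] := hG calA_ub.
have [|+ _] := H1Cnorm_le mu0 (domain_two_points d0 hOmega) (c := 0) (y :=
  DG ub (c *: h + k) - (c *: DG ub h + DG ub k)).
  by rewrite lin.
by move=> /(_ x cx); rewrite normr_le0 subr_eq0 => /eqP.
Qed.

Lemma DG_zero x : closure Omega x -> z 0 x = 0.
Proof.
have Lu : L2 Omega ub by case: hub.
have L0 : L2 Omega 0 by rewrite -(subrr ub); exact: (L2_sub mO).
move=> cx; have := DG_linear 1 L0 L0 cx; rewrite scaler0 addr0 mul1r => /eqP.
by rewrite -subr_eq0 opprD addNKr oppr_eq0 => /eqP.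
Qed.

Lemma DG_scale c h x : L2 Omega h -> closure Omega x -> z (c *: h) x = c * z h x.
Proof.
have Lu : L2 Omega ub by case: hub.
have L0 : L2 Omega 0 by rewrite -(subrr ub); exact: (L2_sub mO).
by move=> Lh cx; rewrite -[c *: h]addr0 DG_linear// DG_zero// addr0.
Qed.

Lemma DG_sub h k x : L2 Omega h -> L2 Omega k -> closure Omega x ->
  z (h - k) x = z h x - z k x.
Proof.
by move=> Lh Lk cx; rewrite addrC -scaleN1r DG_linear// mulN1r addrC.
Qed.

(** The operator bound read pointwise: unit controls have uniformly bounded, uniformly Holder
    linearized states, as the compactness argument requires. *)
Lemma DG_bounded : exists C, forall v, L2 Omega v ->
  (forall x, closure Omega x -> `|z v x| <= C * N v) /\
  (forall x y, closure Omega x -> closure Omega y ->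
    `|z v x - z v y| <= C * N v * enorm (x - y) `^ mu).
Proof.
have [[_ _ [C hC]] _ _ _ _] := hG calA_ub; exists C => v Lv.
apply: (H1Cnorm_le mu0 (domain_two_points d0 hOmega)).
by rewrite EFinM -L2norm_EFin//; exact: hC.
Qed.

Lemma G_increment (e : R) : 0 < e -> exists2 delta, 0 < delta &
  forall v (t : R), L2 Omega v -> calA Omega a0 eps (ub + t *: v) ->
    `|t| * N v < delta ->
  forall x, closure Omega x ->
    `|(G (ub + t *: v)).1 x - (G ub).1 x - t * z v x| <= e * (`|t| * N v).
Proof.
move=> e0; have [_ _ h _ _] := hG calA_ub; have [delta D0 hd] := h e e0.
exists delta => // v t Lv tA tv x cx.
have Ltv : L2 Omega (t *: v) by exact: (L2_scale mO).
have Ntv : N (t *: v) = `|t| * N v by rewrite /L2norm (L2norm_scale mO).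
rewrite -Ntv -DG_scale//.
have [|+ _] := H1Cnorm_le mu0 (domain_two_points d0 hOmega)
  (c := e * N (t *: v)) (y := G (ub + t *: v) - G ub - DG ub (t *: v)).
  by rewrite EFinM -L2norm_EFin//; apply: hd => //;
    rewrite L2norm_EFin// Ntv lte_fin.
exact.
Qed.



Lemma DJ_scale u (c : R) h : calA Omega a0 eps u -> L2 Omega h ->
  DJ u (c *: h) = c * DJ u h.
Proof.
move=> uA Lh; have Lu : L2 Omega ub by case: hub.
have L0 : L2 Omega 0 by rewrite -(subrr ub); exact: (L2_sub mO).
have [[_ lin _] _ _ _ _] := hJ uA.
have DJ0 : DJ u 0 = 0.
  have := lin 1 _ _ L0 L0; rewrite scaler0 addr0 => -[/eqP].
  by rewrite normr_eq0 [1 *: _]mul1r opprD addNKr oppr_eq0 => /eqP.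
by have := lin c _ _ Lh L0; rewrite addr0 DJ0 addr0 => -[/eqP];
  rewrite normr_eq0 subr_eq0 => /eqP.
Qed.

Lemma D2J_linear_l (c : R) h1 h2 k : L2 Omega h1 -> L2 Omega h2 -> L2 Omega k ->
  D2J ub (c *: h1 + h2) k = c * D2J ub h1 k + D2J ub h2 k.
Proof.
move=> l1 l2 lk; have [_ [_ lin _ _] _ _ _] := hJ calA_ub.
by have [/eqP] := lin c _ _ _ l1 l2 lk; rewrite normr_eq0 subr_eq0 => /eqP.
Qed.

Lemma D2J_linear_r (c : R) h k1 k2 : L2 Omega h -> L2 Omega k1 -> L2 Omega k2 ->
  D2J ub h (c *: k1 + k2) = c * D2J ub h k1 + D2J ub h k2.
Proof.
move=> lh l1 l2; have [_ [_ _ lin _] _ _ _] := hJ calA_ub.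
by have [/eqP] := lin c _ _ _ lh l1 l2; rewrite normr_eq0 subr_eq0 => /eqP.
Qed.

Lemma D2J_bounded : exists M, forall h k, L2 Omega h -> L2 Omega k ->
  `|D2J ub h k| <= M * (N h * N k).
Proof.
have [_ [_ _ _ [M hM]] _ _ _] := hJ calA_ub; exists M => h k Lh Lk.
by have := hM h k Lh Lk; rewrite (L2norm_EFin Lh) (L2norm_EFin Lk) -!EFinM lee_fin.
Qed.

Lemma D2J_scale_l (c : R) h k : L2 Omega h -> L2 Omega k ->
  D2J ub (c *: h) k = c * D2J ub h k.
Proof.
move=> Lh Lk; have Lu : L2 Omega ub by case: hub.
have L0 : L2 Omega 0 by rewrite -(subrr ub); exact: (L2_sub mO).
have D0 : D2J ub 0 k = 0.
  have := D2J_linear_l 1 L0 L0 Lk; rewrite scaler0 addr0 mul1r => /eqP.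
  by rewrite -subr_eq0 opprD addNKr oppr_eq0 => /eqP.
by rewrite -[c *: h]addr0 D2J_linear_l// D0 addr0.
Qed.

Let Jb v (t : R) := J Omega L nu G (ub + t *: v).

Lemma J_is_derive v (w : R) : L2 Omega v -> `|w| * N v < eps ub ->
  is_derive w 1 (Jb v) (DJ (ub + w *: v) v).
Proof.
move=> Lv wv; have wA := calA_near Lv wv.
have N0 : 0 <= N v by exact: L2norm_ge0.
have N1 : 0 < N v + 1 by rewrite ltr_wpDl.
apply: is_derive_of_little_o => e e0.
have [_ _ hd _ _] := hJ wA.
have [delta D0 {}hd] := hd _ (divr_gt0 e0 N1).
have r0 : 0 < Num.min delta (eps ub - `|w| * N v) by rewrite lt_min D0 subr_gt0.
(* The increment has to satisfy the differentiability estimate and to stay in the ball around [ub];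
   the denominator [N v + 1] covers [N v = 0]. *)
exists (Num.min delta (eps ub - `|w| * N v) / (N v + 1)); first by rewrite divr_gt0.
move=> s; rewrite ltr_pdivlMr// lt_min => /andP[s1 s2].
have sN : `|s| * N v <= `|s| * (N v + 1) by rewrite ler_wpM2l// lerDl.
have E : ub + (w + s) *: v = ub + w *: v + s *: v by rewrite scalerDl addrA.
have Nsv : N (s *: v) = `|s| * N v by rewrite /L2norm (L2norm_scale mO).
have Lsv : L2 Omega (s *: v) by exact: (L2_scale mO).
have := hd (s *: v) Lsv _ _;
  rewrite /Jb E L2norm_EFin// Nsv lte_fin -EFinM lee_fin DJ_scale//.
rewrite [s * _]mulrC => h; apply: le_trans (h _ _) _.
- rewrite -E; apply: calA_near => //.
  apply: (@le_lt_trans _ _ (`|w| * N v + `|s| * N v)).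
    by rewrite -mulrDl ler_wpM2r// ler_normD.
  by rewrite -ltrBrDl; exact: le_lt_trans sN s2.
- exact: le_lt_trans sN s1.
rewrite -mulrA ler_wpM2l ?(ltW e0)// ler_pdivrMl//.
by rewrite [leRHS]mulrC.
Qed.

(** Along the line through [ub] with direction [v], the expansion of [DJ] at [ub] is the hypothesis
    of [second_difference_le], with slope [D2J ub v v] and constant [e * N v ^+ 2]. *)
Lemma J_second_difference v (e : R) : L2 Omega v -> 0 < e -> exists2 delta,
  0 < delta &
  forall t, 0 <= t -> t * N v < delta ->
    `|Jb v t + Jb v (- t) - 2 * Jb v 0 - t ^+ 2 * D2J ub v v| <= 2 * (e * N v ^+
      2) * t ^+ 2.
Proof.
move=> Lv e0; have [_ _ _ h _] := hJ calA_ub; have [delta D0 hd] := h e e0.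
have N0 : 0 <= N v by exact: L2norm_ge0.
have e1 := eps0 hub.
exists (Num.min delta (eps ub)); first by rewrite lt_min D0.
move=> t t0; rewrite lt_min => /andP[t1 t2].
have wt (w c : R) : t * N v < c -> `|w| <= t -> `|w| * N v < c.
  by move=> tc w_t; apply: le_lt_trans tc; rewrite ler_wpM2r.
apply: (second_difference_le (dj := fun w => DJ (ub + w *: v) v)) => // w w_t.
  by apply: J_is_derive => //; exact: wt.
have Lwv : L2 Omega (w *: v) by exact: (L2_scale mO).
have := hd (w *: v) v Lwv Lv (calA_near Lv (wt _ _ t2 w_t)).
have Nwv : N (w *: v) = `|w| * N v by rewrite /L2norm (L2norm_scale mO).
rewrite (L2norm_EFin Lwv) Nwv (L2norm_EFin Lv) lte_fin -!EFinM lee_fin.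
rewrite scale0r addr0 D2J_scale_l// => h'; apply: le_trans (h' (wt _ _ t1 w_t)) _.
by rewrite le_eqVlt; apply/orP; left; apply/eqP; ring.
Qed.


(** Undoing the transposition of the coefficients gives the same bilinear form as in the state
    equation tested with [phib], so the two can be equated. *)
Lemma adjoint_tested (psi : @weak_fun R d) : H1 Omega psi ->
  \int[leb]_(x in Omega) (\sum_i \sum_j A x i j * psi.2 x 0 i * phib.2 x 0 j) =
  \int[leb]_(x in Omega) ((dy L x (yb.1 x) -
     (dy a x (yb.1 x) * phib.1 x + ub x * phib.1 x)) * psi.1 x).
Proof.
move=> hpsi; have [_ /(_ _ hpsi)] := hadj.
have -> : \int[@surface R d]_(x in bdry Omega) (0 * trace Omega psi x) = 0.
  by rewrite /Rintegral integral0_eq// => x _; rewrite mul0r.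
rewrite addr0 => <-; apply: eq_Rintegral => x _.
rewrite exchange_big; apply: eq_bigr => i _; apply: eq_bigr => j _.
by rewrite /adjoint_coef mxE; ring.
Qed.

(** [B] and [C] must not depend on [v], [t] or [s]. The restriction [s <= 1] ensures it: all states
    involved stay below one [M], which fixes the local constants of [a] and [L]. *)
Lemma J_expansion : exists B C (ell : ('rV[R]_d -> R) -> R), [/\ 0 <= B, 0 <= C &
  forall v (t s : R), L2 Omega v -> calA Omega a0 eps (ub + t *: v) ->
    0 <= s <= 1 ->
  (forall x, closure Omega x -> `|(G (ub + t *: v)).1 x - (G ub).1 x| <= s) ->
  `|Jb v t - Jb v 0 - t * ell v - nu / 2 * t ^+ 2 * N v ^+ 2| <=
    B * s ^+ 2 + C * (`|t| * s * N v)].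
Proof.
have Lu : L2 Omega ub by case: hub.
have [hGub _] := G_state calA_ub.
have [cG cGP] := H1C_bounded hGub; have [cy cyP] := H1C_bounded hyb.
have [b bP] := H1C_bounded hphib.
have [[ma da] /(Lp_integrable mO mOoo p1) a0I _ aC _] := ha.
have [[mL dL] /(Lp_integrable mO mOoo (lexx _)) L0I LK LC _] := hL.
pose M := `|cG| + `|cy| + 1.
have M0 : 0 < M by rewrite ltr_wpDl// addr_ge0.
have [Ca {}aC] := aC M M0; have [CL {}LC] := LC M M0.
have [KL /(Lp_integrable mO mOoo p1) KLI {}LK] := LK M M0.
have clO x : Omega x -> closure Omega x by exact: subset_closure.
have der (f : 'rV[R]_d -> R -> R) : {ae leb, forall x, Omega x ->
     [/\ forall y : R, derivable (f x) y 1, forall y : R, derivable (dy f x) y 1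
       & continuous (dyy f x)]} -> {ae leb, forall x, Omega x ->
     (forall s : R, derivable (f x) s 1) /\ forall s : R,
       derivable (derive1 (f x)) s 1}.
  apply: lebesgue_ae_imp => x + Ox => /(_ Ox)[h1 h2 _].
  by split; [exact: h1|exact: h2].
have yM x : Omega x -> `|yb.1 x| <= M.
  move=> /clO /cyP h; apply: le_trans h _; rewrite /M -addrA addrC -addrA.
  by rewrite (le_trans (ler_norm _))// lerDl addr_ge0.
pose ell v := nu * \int[leb]_(x in Omega) (ub x * v x) -
  \int[leb]_(x in Omega) (v x * phib.1 x * yb.1 x).
pose B := (`|CL| + `|Ca| * `|b|) * fine (leb Omega).
exists B, (`|b| * N (fun=> 1)), ell; split.
- by rewrite mulr_ge0 ?fine_ge0// addr_ge0// mulr_ge0.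
- by rewrite mulr_ge0// L2norm_ge0.
move=> v t s Lv tA /andP[s0 s1] Gs.
have [hGt [_ /(_ _ hphib.1) st]] := G_state tA.
have [_ /(_ _ hphib.1) s_0] := hstate.
have aK : {ae leb, forall x, Omega x -> forall s, `|s| <= M ->
  `|derive1 (a x) s| <= Ca}.
  apply: lebesgue_ae_imp aC => x + Ox r rM => /(_ Ox r rM); apply: le_trans.
  by rewrite lerDl.
have aC' : {ae leb, forall x, Omega x -> forall s, `|s| <= M ->
  `|derive1n 2 (a x) s| <= Ca}.
  apply: lebesgue_ae_imp aC => x + Ox r rM => /(_ Ox r rM); apply: le_trans.
  by rewrite lerDr.
have GtM x : Omega x -> `|(G (ub + t *: v)).1 x| <= M.
  move=> /clO Ox; rewrite -(subrK ((G ub).1 x) ((G _).1 x)) (le_trans (ler_normD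
    _ _))//.
  rewrite /M (le_trans (lerD (le_trans (Gs x Ox) s1) (le_trans (cGP x Ox)
    (ler_norm _))))//.
  by rewrite addrC lerD2r lerDl.
have GuM x : Omega x -> `|(G ub).1 x| <= M.
  move=> /clO /cGP h; apply: le_trans (le_trans h (ler_norm _)) _.
  by rewrite /M -addrA lerDl addr_ge0.
have zys : {ae leb, forall x, Omega x -> `|(G (ub + t *: v)).1 x - yb.1 x| <= s}.
  by apply: lebesgue_ae_imp G_ub_ae => x + Ox => /(_ Ox) ->; exact/Gs/clO.
have phb x : Omega x -> `|phib.1 x| <= `|b|.
  by move=> /clO /bP h; exact: le_trans h (ler_norm _).
have := reduced_cost_expansion cm mO mOoo nu ma mL (der _ da) (der _ dL) a0I L0I KLI
  aK LK aC' LC (H1C_measurable hphib) phb (H1C_measurable hyb) yM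
    (H1C_measurable hGt) GtM zys
  s0 (normr_ge0 b) Lu Lv st s_0 (adjoint_tested hGt.1) (adjoint_tested hyb.1).
have -> : \int[leb]_(x in Omega) L x (yb.1 x) = \int[leb]_(x in Omega) L x ((G
  ub).1 x).
  apply: (ae_eq_Rintegral cm mO).
    exact: (integrable_measurable (superposition_integrable cm mO mL (der _ dL)
      L0I KLI LK (H1C_measurable hyb) yM)).
  by apply: lebesgue_ae_imp G_ub_ae => x + Ox => /(_ Ox) ->.
rewrite /Jb scale0r addr0 => h; apply: le_trans h _.
rewrite lerD2r /B ler_wpM2r ?sqr_ge0// ler_wpM2r ?fine_ge0//.
by apply: lerD; [exact: ler_norm|rewrite ler_wpM2r// ler_norm].
Qed.

(** [J_expansion] is used at [t] and [- t], which cancels [ell], with state increments at most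
    [t * S] by differentiability of [G]. Comparison with [J_second_difference] and division by
    [t ^+ 2] give the inequality up to [e * K] for every [e] in []0, 1]]. *)
Lemma D2J_garding : exists C, 0 <= C /\ forall v (s : R), L2 Omega v -> 0 <= s ->
  (forall x, closure Omega x -> `|z v x| <= s) ->
  nu * N v ^+ 2 - C * (s ^+ 2 + s * N v) <= D2J ub v v.
Proof.
have [B [C [ell [B0 C0 JE]]]] := J_expansion.
exists (2 * (B + C)); split; first by rewrite mulr_ge0// addr_ge0.
move=> v s Lv s0 zs; have N0 : 0 <= N v by exact: L2norm_ge0.
set n := N v in N0 *.
(* [K] collects the coefficients of [e] from [S ^+ 2], from [S * n] and from the second difference;
   [e <= 1] absorbs the term in [e ^+ 2]. *)
pose K := 2 * B * (2 * s * n + n ^+ 2) + 2 * C * n ^+ 2 + 2 * n ^+ 2.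
have sn0 : 0 <= s * n by rewrite mulr_ge0.
have K0 : 0 <= K by rewrite !addr_ge0// !mulr_ge0// ?addr_ge0// ?mulr_ge0//
  ?sqr_ge0.
suff main (e : R) : 0 < e <= 1 ->
    nu * n ^+ 2 - 2 * (B + C) * (s ^+ 2 + s * n) <= D2J ub v v + e * K.
  apply/ler_addgt0Pr => e e0.
  have K1 : 0 < K + 1 by rewrite ltr_wpDl.
  pose e' := Num.min 1 (e / (K + 1)).
  have e'0 : 0 < e' by rewrite lt_min ltr01 divr_gt0.
  have e'1 : e' <= 1 by rewrite ge_min lexx.
  have := main e'; rewrite e'0 e'1 => /(_ isT) h; apply: le_trans h _.
  rewrite lerD2l; apply: (@le_trans _ _ (e / (K + 1) * K)).
    by rewrite ler_wpM2r// ge_min lexx orbT.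
  by rewrite mulrAC ler_pdivrMr// ler_wpM2l ?(ltW e0)// lerDl.
move=> /andP[e0 e1].
have [d1 d1_0 Gd] := G_increment e0.
have [d2 d2_0 Jd] := J_second_difference Lv e0.
pose S := s + e * n.
have S0 : 0 <= S by rewrite addr_ge0// mulr_ge0// ltW.
have [t [t0 t1 t2 t3 t4]] : exists t, [/\ 0 < t, t * n < d1, t * n < d2,
  t * n < eps ub & t * S <= 1].
  (* Taking [t * (n + S + 1) = r] puts [t * n] and [t * S] below all four bounds; the summand 1
     makes this strict. *)
  pose r := Num.min (Num.min d1 d2) (Num.min (eps ub) 1).
  have r0 : 0 < r by rewrite !lt_min d1_0 d2_0 eps0// ltr01.
  have q0 : 0 < n + S + 1 by rewrite ltr_wpDl// addr_ge0.
  pose t := r / (n + S + 1); have t0 : 0 < t by rewrite divr_gt0.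
  have tq : t * n + t * S + t = r by rewrite -mulrDr -[X in _ + X]mulr1 -mulrDr
    divfK// gt_eqF.
  have tn0 : 0 <= t * n by rewrite mulr_ge0// ltW.
  have tS0 : 0 <= t * S by rewrite mulr_ge0// ltW.
  have tnr : t * n < r by lra.
  have tSr : t * S < r by lra.
  move: (tnr); rewrite !lt_min => /andP[/andP[? ?] /andP[? _]].
  by exists t; split=> //; move: tSr; rewrite !lt_min => /andP[_ /andP[_ /ltW]].
have step w : `|w| = t ->
  `|Jb v w - Jb v 0 - w * ell v - nu / 2 * t ^+ 2 * n ^+ 2| <=
    t ^+ 2 * (B * S ^+ 2 + C * (S * n)).
  move=> wt; have wA : calA Omega a0 eps (ub + w *: v) by apply: calA_near =>
    //; rewrite wt.
  have w2 : w ^+ 2 = t ^+ 2 by rewrite -wt real_normK ?num_real.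
  have := JE v w (t * S) Lv wA; rewrite wt w2.
  have -> : B * (t * S) ^+ 2 + C * (t * (t * S) * N v) = t ^+ 2 * (B * S ^+ 2 +
    C * (S * n)).
    by rewrite /n; ring.
  apply; first by rewrite mulr_ge0// ltW.
  move=> x cx; have := Gd v w Lv wA; rewrite wt => /(_ t1 x cx) h.
  rewrite -(subrK (w * z v x) (_ - _)) (le_trans (ler_normD _ _))// normrM wt.
  have := ler_wpM2l (ltW t0) (zs x cx); rewrite /S mulrDr mulrCA -/n in h *.
  by move: h; lra.
have sp := step t (gtr0_norm t0).
have sm := step (- t); rewrite normrN gtr0_norm// in sm; have {}sm := sm erefl.
have := Jd t (ltW t0) t2; rewrite -/n.
move: sp sm; rewrite !ler_norml mulNr => /andP[sp _] /andP[sm _] /andP[_ J2].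
have tt : 0 < t ^+ 2 by rewrite exprn_gt0.
rewrite -(ler_pM2l tt).
have SS : S ^+ 2 <= s ^+ 2 + e * (2 * s * n + n ^+ 2).
  rewrite (_ : S ^+ 2 = s ^+ 2 + e * (2 * s * n + e * n ^+ 2));
    last by rewrite /S; ring.
  by rewrite lerD2l ler_wpM2l ?(ltW e0)// lerD2l ler_piMl ?sqr_ge0//.
have h1 : t ^+ 2 * (B * S ^+ 2) <= t ^+ 2 * (B * (s ^+ 2 + e * (2 * s * n + n ^+
  2))).
  by apply: ler_wpM2l; [exact: ltW|exact: ler_wpM2l].
have Sn : S * n = s * n + e * n ^+ 2 by rewrite /S; ring.
(* The slack between [B * s ^+ 2 + C * (s * n)] and [(B + C) * (s ^+ 2 + s * n)]. *)
have h2 : 0 <= t ^+ 2 * (B * (s * n) + C * s ^+ 2).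
  by rewrite mulr_ge0 ?(ltW tt)// addr_ge0// mulr_ge0// sqr_ge0.
rewrite Sn in sp sm; rewrite /K.
have nn : 0 <= n ^+ 2 by exact: sqr_ge0.
have h3 : 0 <= t ^+ 2 * (e * (C * n ^+ 2)).
  by rewrite mulr_ge0 ?(ltW tt)// mulr_ge0 ?(ltW e0)// mulr_ge0.
move: sp sm J2 h1 h2 h3.
move: (Jb v t) (Jb v (- t)) (Jb v 0) (ell v) (D2J ub v v) => j1 j2 j3 l q.
move=> sp sm J2 h1 h2 h3; lra.
Qed.

End control_problem.

(** * The critical cone and the subspaces [T_] *)

Section critical_cone.
Context {R : realType} {d : nat}.
Variables (Omega : set 'rV[R]_d) (nu : R) (u y phi : 'rV[R]_d -> R).
Hypothesis mO : measurable (Omega : set (caratheodory_type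
  (@lebesgue_outer_measure R d))).
Local Notation T := (T_ Omega nu u y phi).

(** Off the null set [Sigma_], an active constraint forces [dJ <> 0]. An element of [T 0] thus
    vanishes there and satisfies the sign conditions trivially; the converse is the first condition
    of the cone. *)
Lemma T0_eq_critical_cone (alpha : R) (beta : \bar R) :
  @lebesgue R d (Sigma_ Omega alpha beta nu u y phi) = 0%E ->
  T 0 = critical_cone Omega alpha beta nu u y phi.
Proof.
move=> /lebesgue_ae_null nS; apply/seteqP; split=> v [Lv].
  move=> Tv; split=> //; apply: lebesgue_ae_imp2 Tv nS => x h nSx Ox.
  have v0 : dJ nu u y phi x <> 0 -> v x = 0.
    by move=> /eqP dJ0; apply: h => //; rewrite normr_gt0.
  split=> // ux.
    have [dJ0|/eqP /v0 -> //] := eqVneq (dJ nu u y phi x) 0.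
    by case: nSx; split=> //; left.
  have [dJ0|/eqP /v0 -> //] := eqVneq (dJ nu u y phi x) 0.
  by case: nSx; split=> //; right.
move=> Cv; split=> //; apply: lebesgue_ae_imp Cv => x h Ox.
by rewrite normr_gt0 => /eqP; have [] := h Ox.
Qed.

Lemma T_linear tau (c : R) v w : T tau v -> T tau w -> T tau (c *: v + w).
Proof.
move=> [Lv v0] [Lw w0]; split; first exact: (L2_linear mO).
apply: lebesgue_ae_imp2 v0 w0 => x vx wx Ox dx.
by rewrite (_ : (c *: v + w) x = c * v x + w x)// vx// wx// mulr0 addr0.
Qed.

Lemma T_le tau tau' v : tau <= tau' -> T tau v -> T tau' v.
Proof.
move=> tt [Lv v0]; split=> //; apply: lebesgue_ae_imp v0 => x h Ox dx.
by apply: h => //; exact: le_lt_trans dx.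
Qed.

Lemma T0P v : (forall n, T n.+1%:R^-1 v) -> T 0 v.
Proof.
move=> Tv; have Lv : L2 Omega v by have [] := Tv 0%N.
split=> //; have := lebesgue_ae_forall (fun n => (Tv n).2).
apply: lebesgue_ae_imp => x h Ox dx.
apply: (h (Num.truncn `|dJ nu u y phi x|^-1)) => //.
by rewrite invf_plt ?posrE// truncnS_gt.
Qed.

(** Vanishing at a point survives pointwise limits. The subsequence is shifted by [n], since
    membership in [T tau] is known only from index [n] on. *)
Lemma T_limit tau (v : nat -> 'rV[R]_d -> R) (w : 'rV[R]_d -> R) (f : nat ->
  nat) (n : nat) :
  (forall k, (k <= f k)%N) -> L2 Omega w ->
  {ae @lebesgue R d, forall x, Omega x -> v (f k) x @[k --> \oo] --> w x} ->
  (forall k, (n <= k)%N -> T tau (v k)) -> T tau w.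
Proof.
move=> kf Lw vw Tv; split=> //.
have /lebesgue_ae_forall v0 k : {ae @lebesgue R d, forall x, Omega x ->
    tau < `|dJ nu u y phi x| -> v (f (n + k)%N) x = 0}.
  by apply: (Tv _ _).2; rewrite (leq_trans _ (kf _))// leq_addr.
apply: lebesgue_ae_imp2 v0 vw => x v0 vx Ox dx.
have := vx Ox; rewrite -(cvg_shiftn n) /= => c.
have c0 : v (f (k + n)%N) x @[k --> \oo] --> (0 : R).
  by under eq_cvg do rewrite addnC v0//; exact: cvg_cst.
exact: (cvg_unique _ c c0).
Qed.

End critical_cone.

Lemma Uad_sub_calA0 {R : realType} {d : nat} (Omega : set 'rV[R]_d) (a0 alpha : R)
  (beta : \bar R) (u : 'rV[R]_d -> R) :
  - a0 < alpha -> Uad Omega alpha beta u -> calA0 Omega a0 u.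
Proof.
move=> a0alpha [Lu ua]; split=> //.
apply: (@lt_le_trans _ _ (a0%:E + alpha%:E)%E);
  first by rewrite lte_fin -ltrBlDl sub0r.
rewrite leeD2l//; apply/ess_infP; apply: lebesgue_ae_imp ua => x h.
rewrite /patch; case: ifPn => [|_]; last by rewrite leey.
by rewrite inE => /h /andP[].
Qed.

Unset Implicit Arguments.

Theorem theorem3p10 (R : realType) (d : nat) (hd : d = 2%N \/ d = 3%N)
  (Omega : set 'rV[R]_d) (hOmega : lipschitz_domain Omega)
  (A : 'rV[R]_d -> 'M[R]_d) (MA LamA : R) (hA : elliptic Omega A MA LamA)
  (p q : \bar R) (hp : ((d%:R / 2)%:E < p)%E) (hq : ((d%:R - 1)%:E < q)%E)
  (a : 'rV[R]_d -> R -> R) (a0 : R) (ha : nonlinearity Omega p a a0)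
  (g : 'rV[R]_d -> R) (hg : Lp (@surface R d) (bdry Omega) q g)
  (L : 'rV[R]_d -> R -> R) (hL : cost_integrand Omega p L)
  (nu alpha : R) (beta : \bar R) (hnu : 0 < nu) (halpha : - a0 < alpha)
  (hbeta : (alpha%:E < beta)%E)
  (mu : R) (hmu : holder_exponent Omega A p q mu)
  (C4 : R) (eps : ('rV[R]_d -> R) -> R)
  (G : ('rV[R]_d -> R) -> weak_fun)
  (hG : control_to_state Omega A LamA a a0 g mu C4 eps G)
  (DJ : ('rV[R]_d -> R) -> ('rV[R]_d -> R) -> R)
  (D2J : ('rV[R]_d -> R) -> ('rV[R]_d -> R) -> ('rV[R]_d -> R) -> R)
  (hJ : C2_on (L2 Omega) (L2norm Omega) setT (fun r : R => `|r|%:E)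
          (calA Omega a0 eps) (J Omega L nu G) DJ D2J)
  (ub : 'rV[R]_d -> R) (yb phib : weak_fun)
  (hub : Uad Omega alpha beta ub) (hyb : H1C Omega mu yb)
  (hphib : H1C Omega mu phib)
  (hstate : state_eq Omega A a g ub yb)
  (hadj : adjoint_eq Omega A a L ub yb phib)
  (hproj : {ae @lebesgue R d, forall x, Omega x ->
     (ub x)%:E = Proj alpha beta (nu^-1 * (yb.1 x * phib.1 x))})
  (hSigma : @lebesgue R d (Sigma_ Omega alpha beta nu ub yb.1 phib.1) = 0%E) :
  T_ Omega nu ub yb.1 phib.1 0 =
    critical_cone Omega alpha beta nu ub yb.1 phib.1 /\
  ((forall v, critical_cone Omega alpha beta nu ub yb.1 phib.1 v ->
      ~ {ae @lebesgue R d, forall x, Omega x -> v x = 0} ->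
      0 < D2J ub v v) ->
   exists tau kappa : R, [/\ 0 < tau, 0 < kappa
     & forall v, T_ Omega nu ub yb.1 phib.1 tau v ->
         kappa * fine (L2norm Omega v) ^+ 2 <= D2J ub v v]).
Proof.
have mO := domain_measurable hOmega; have mOoo := domain_finite_measure hOmega.
have T0C := T0_eq_critical_cone hSigma; split=> // pos.
have d0 : (0 < d)%N by case: hd => ->.
(* As [d] is at least 2, the bound [d / 2] is at least 1. *)
have p1 : (1 <= p)%E.
  apply: le_trans (ltW hp); rewrite lee_fin ler_pdivlMr// mul1r ler_nat.
  by case: hd => ->.
have mu0 : 0 < mu by have [/andP[]] := hmu.
have ubA0 := Uad_sub_calA0 halpha hub.
have [_ eps_rad G_sol [DG [D2G GC2]]] := hG.
have eps0 u : calA0 Omega a0 u -> 0 < eps u by move=> /eps_rad[].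
have G_state u : calA Omega a0 eps u ->
  H1C Omega mu (G u) /\ state_eq Omega A a g u (G u).
  by move=> /G_sol[].
have G_unique u y : calA Omega a0 eps u -> H1C Omega mu y ->
  state_eq Omega A a g u y ->
    {ae @lebesgue R d, forall x, Omega x -> y.1 x = (G u).1 x}.
  by move=> /G_sol[_ _]; apply.
have [C [C0 gard]] := D2J_garding d0 hOmega p1 ha hL mu0 eps0 G_state G_unique
  GC2 hJ
  ubA0 hyb hphib hstate hadj.
have [M B_le] := D2J_bounded hOmega eps0 hJ ubA0.
have [CG zC] := DG_bounded d0 hOmega mu0 eps0 GC2 ubA0.
(* These subspaces decrease to [T 0], which is the critical cone by [T0C]. *)
pose S n := T_ Omega nu ub yb.1 phib.1 n.+1%:R^-1.
have SL n v : S n v -> L2 Omega v by case.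
have S_decr m n : (m <= n)%N -> S n `<=` S m.
  by move=> mn v; apply: T_le; rewrite lef_pV2 ?posrE// ler_nat ltnS.
have compact_DG v : (forall k, S 0%N (v k) /\ fine (L2norm Omega (v k)) = 1) ->
    exists f : nat -> nat, (forall k, (k <= f k)%N) /\
    forall e, 0 < e -> exists n, forall k l, (n <= k)%N -> (n <= l)%N ->
      forall x, closure Omega x -> `|(DG ub (v (f k) - v (f l))).1 x| <= e.
  move=> v1; have Lv k := SL _ _ (v1 k).1.
  have zb k x : closure Omega x -> `|(DG ub (v k)).1 x| <= CG.
    by move=> cx; have := (zC _ (Lv k)).1 x cx; rewrite (v1 k).2 mulr1.
  have zh k x y : closure Omega x -> closure Omega y ->
      `|(DG ub (v k)).1 x - (DG ub (v k)).1 y| <= CG * enorm (x - y) `^ mu.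
    by move=> cx cy; have := (zC _ (Lv k)).2 x y cx cy; rewrite (v1 k).2 mulr1.
  have [f [kf fP]] := uniform_cauchy_subsequence (closure_domain_compact hOmega)
    zb (holder_equicontinuous mu0 zh).
  exists f; split=> // e /fP[n nP]; exists n => k l nk nl x cx.
  by rewrite (DG_sub d0 hOmega mu0 eps0 GC2 ubA0 (Lv _) (Lv _) cx); exact: nP.
have complete v : (forall k, S 0%N (v k)) ->
    (forall e, 0 < e -> exists n, forall k l, (n <= k)%N -> (n <= l)%N ->
      fine (L2norm Omega (v k - v l)) < e) ->
    exists w, (forall n, (forall k, (n <= k)%N -> S n (v k)) -> S n w) /\
      forall e, 0 < e -> exists n, forall k, (n <= k)%N ->
        fine (L2norm Omega (v k - w)) < e.
  move=> v0 vC; have Lv k := SL _ _ (v0 k).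
  have [w [Lw [f [kf vw]] wC]] :=
    L2_complete (@lebesgue_complete R d) mO mOoo Lv vC.
  by exists w; split=> // n nS; exact: T_limit kf Lw vw nS.
have S_pos v : (forall n, S n v) -> fine (L2norm Omega v) <> 0 -> 0 < D2J ub v v.
  move=> Sv Nv; apply: pos; first by rewrite -T0C; exact: T0P.
  move=> v0; apply: Nv; apply/eqP; rewrite -sqrf_eq0 /L2norm L2norm_sqr//;
    last exact: SL (Sv 0%N).
  rewrite -(ae_eq_Rintegral (@lebesgue_complete R d) mO (f := fun=> 0))//.
    by rewrite Rintegral_cst// mul0r.
  by apply: lebesgue_ae_imp v0 => x h Ox; rewrite h// expr0n.
have [n [kappa [k0 coer]]] : exists n kappa, 0 < kappa /\ forall v, S n v ->
    kappa * fine (L2norm Omega v) ^+ 2 <= D2J ub v v.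
  apply: (@coercive_of_positive _ _ S (fun v => fine (L2norm Omega v)) (D2J ub)
    (fun v s => forall x, closure Omega x -> `|(DG ub v).1 x| <= s) nu C M) => //.
  - by move=> n c h k; exact: T_linear.
  - by move=> h; exact: L2norm_ge0.
  - by move=> c h /SL; exact: L2norm_scale.
  - by move=> h k /SL Lh /SL; exact: L2norm_triangle.
  - by move=> h k /SL Lh /SL; exact: L2norm_parallelogram.
  - by move=> c h1 h2 k /SL l1 /SL l2 /SL;
      exact: (D2J_linear_l hOmega eps0 hJ ubA0).
  - by move=> c h k1 k2 /SL l1 /SL l2 /SL;
      exact: (D2J_linear_r hOmega eps0 hJ ubA0).
  - by move=> h k /SL Lh /SL; exact: B_le.
  - by move=> h s /SL; exact: gard.
by exists n.+1%:R^-1, kappa; split.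
Qed.
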